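(* Let $U:\Omega_1\times\Omega_2\to[0,1]$ be a bigraphon whose essential supremum $p=\operatorname{ess\,sup}U$ satisfies $0<p<1$. Then for every $\epsilon>0$, $$\Pr\left[\,\left|\omega_2(\mathbb B(n,U))-\frac{2}{\log(1/p)}\log n\right|\le \epsilon\log n\,\right]\to1\quad (n\to\infty).$$
   Context: A bigraphon is a measurable function $U:\Omega_1\times\Omega_2\to[0,1]$, where $\Omega_1,\Omega_2$ are atomless standard Borel probability spaces with measures $\nu_1,\nu_2$. The random bipartite graph $\mathbb B(n,U)$ has colour classes $\{a_1,\dots,a_n\}$ and $\{b_1,\dots,b_n\}$: sample $x_1,\dots,x_n\in\Omega_1$ and $y_1,\dots,y_n\in\Omega_2$ independently according to $\nu_1,\nu_2$, and join $a_i$ to $b_j$ independently with probability $U(x_i,y_j)$. For a bipartite graph $G=(A,B;E)$, the biclique number $\omega_2(G)$ is the largest $\ell$ such that there are $X\subseteq A$, $Y\subseteq B$ with $|X|=|Y|=\ell$ and every vertex of $X$ adjacent to every vertex of $Y$. $\log$ is the natural logarithm. *)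

(* Defs.v *)
From HB Require Import structures.
From mathcomp Require Import all_boot all_order all_algebra.
From mathcomp Require Import all_classical all_reals all_analysis measurable_realfun.
From mathcomp Require Import lra.

Set Implicit Arguments.
Unset Strict Implicit.
Unset Printing Implicit Defensive.

Import Order.TTheory GRing.Theory Num.Theory.
Import numFieldNormedType.Exports.

Local Open Scope classical_set_scope.
Local Open Scope ring_scope.

(* Through the bijection [f], the sigma-algebra of [T] is the Borel
   sigma-algebra of a complete separable metric space; Hausdorff turns the
   library's pseudometric into a metric. *)
Definition standard_borel (R : realType) d (T : measurableType d) : Prop :=
  exists (X : completePseudoMetricType R) (f : T -> X),
    [/\ hausdorff_space X,
        exists2 D : set X, countable D & dense D,
        bijective f
      & forall A : set T, measurable A <-> <<s [set B | open B] >> (f @` A)].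

Definition atomless (R : realType) d (T : measurableType d)
    (mu : {measure set T -> \bar R}) : Prop :=
  forall A : set T, measurable A -> (0 < mu A)%E ->
  exists B : set T, [/\ measurable B, B `<=` A & (0 < mu B < mu A)%E].

Definition bigraphon (R : realType) d1 d2
    (T1 : measurableType d1) (T2 : measurableType d2)
    (U : T1 * T2 -> R) : Prop :=
  measurable_fun [set: T1 * T2] U /\ forall z, 0 <= U z <= 1.

Section iid.
Context (R : realType) d (T : measurableType d).

Definition tuple_cons n (z : T * n.-tuple T) : n.+1.-tuple T :=
  [the n.+1.-tuple T of z.1 :: z.2].

Lemma measurable_tuple_cons n : measurable_fun setT (@tuple_cons n).
Proof. by apply: measurable_cons. Qed.

HB.instance Definition _ n := isMeasurableFun.Build _ _ _ _ (@tuple_cons n)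
  (@measurable_tuple_cons n).

(* The law of [n] independent samples from [P], i.e. the [n]-fold power of
   [P]; see [iidE]. *)
Fixpoint iid (P : probability T R) n : probability (n.-tuple T) R :=
  match n with
  | 0%N => dirac [tuple]
  | m.+1 => distribution (P \x iid P m)%E (@tuple_cons m)
  end.

Lemma iidE (P : probability T R) n (A : 'I_n -> set T) :
  (forall i, measurable (A i)) ->
  (iid P n [set t | forall i, A i (tnth t i)] = \prod_(i < n) P (A i))%E.
Proof.
elim: n A => [|n IHn] A mA.
  rewrite big_ord0 /= diracE mem_set//=; by case.
rewrite big_ord_recl -IHn//= /distribution /pushforward.
rewrite -product_measure1E//; last first.
  rewrite (_ : mkset _ = \bigcap_(i in [set: 'I_n])
      ((@tnth n T)^~ i @^-1` (A (lift ord0 i)))); last first.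
    by apply/seteqP; split => t /= At i => [_|]; exact: At.
  apply: fin_bigcap_measurable => // i _.
  by rewrite -[X in measurable X]setTI; exact: measurable_tnth.
congr (_ _); apply/seteqP; split => -[x t] /=.
  move=> At; split=> [|i]; first by have := At ord0; rewrite tnth0.
  by have := At (lift ord0 i); rewrite tnthS.
by case=> Ax At i; case: (unliftP ord0 i) => [j ->|->]; rewrite ?tnthS ?tnth0.
Qed.

End iid.

(* A bipartite graph with colour classes [A] and [B] is given by its edge set
   [E : {set A * B}]. *)
Section biclique_number.
Variables A B : finType.

Definition biclique (E : {set A * B}) (X : {set A}) (Y : {set B}) : bool :=
  [forall a in X, forall b in Y, (a, b) \in E].

Definition biclique_number (E : {set A * B}) : nat :=
  \max_(XY : {set A} * {set B} |
      biclique E XY.1 XY.2 && (#|XY.1| == #|XY.2|)) #|XY.1|.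

End biclique_number.

Section random_bipartite_graph.
Context (R : realType) d1 d2 (T1 : measurableType d1) (T2 : measurableType d2).
Variables (nu1 : probability T1 R) (nu2 : probability T2 R) (U : T1 * T2 -> R).

(* Conditional probability, given the samples [x] and [y], that the edge set is
   exactly [E]. *)
Definition edge_set_weight n (E : {set 'I_n * 'I_n})
    (x : n.-tuple T1) (y : n.-tuple T2) : R :=
  \prod_(ij : 'I_n * 'I_n)
    let u := U (tnth x ij.1, tnth y ij.2) in if ij \in E then u else 1 - u.

Definition sample_law n : probability (n.-tuple T1 * n.-tuple T2)%type R :=
  (iid nu1 n \x iid nu2 n)%E.

(* Probability that the edge set of B(n,U) is [E]. *)
Definition bigraphon_pmf n (E : {set 'I_n * 'I_n}) : R :=
  \int[sample_law n]_(xy in setT) edge_set_weight E xy.1 xy.2.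

(* Probability that B(n,U) satisfies [Q]. *)
Definition bigraphon_pr n (Q : pred {set 'I_n * 'I_n}) : R :=
  \sum_(E | Q E) bigraphon_pmf E.

Lemma bigraphon_pr_total n : bigraphon U -> @bigraphon_pr n xpredT = 1.
Proof.
move=> [mU U01].
have mUij (ij : 'I_n * 'I_n) : measurable_fun setT
    (fun xy : n.-tuple T1 * n.-tuple T2 => U (tnth xy.1 ij.1, tnth xy.2 ij.2)).
  apply: (@measurableT_comp _ _ _ _ _ _ U) => //.
  apply: measurable_fun_pair.
    exact: (measurableT_comp (measurable_tnth ij.1) measurable_fst).
  exact: (measurableT_comp (measurable_tnth ij.2) measurable_snd).
have mw (E : {set 'I_n * 'I_n}) : measurable_fun setT
    (fun xy : n.-tuple T1 * n.-tuple T2 => edge_set_weight E xy.1 xy.2).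
  apply: measurable_prod => ij _ /=; case: (ij \in E) => //.
  exact: measurable_funB.
have iw (E : {set 'I_n * 'I_n}) : (sample_law n).-integrable setT
    (fun xy => (edge_set_weight E xy.1 xy.2)%:E).
  apply: (@le_integrable _ _ _ _ _ measurableT _ (EFin \o cst 1)) => //.
  - exact/measurable_EFinP.
  - move=> xy _ /=; rewrite lee_fin normr1 ger0_norm /edge_set_weight.
      apply: prodr_ile1 => ij _ /=.
      by have := U01 (tnth xy.1 ij.1, tnth xy.2 ij.2); case: ifP => _; lra.
    apply: prodr_ge0 => ij _ /=.
    by have := U01 (tnth xy.1 ij.1, tnth xy.2 ij.2); case: ifP => _; lra.
  - exact: (finite_measure_integrable_cst (sample_law n) 1).
rewrite /bigraphon_pr /bigraphon_pmf /Rintegral sum_fine => [|E _]; last first.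
  exact: integrable_fin_num.
rewrite -integral_sum//.
rewrite (eq_integral (cst 1%E)) => [|xy _]; last first.
  set u := fun ij : 'I_n * 'I_n => U (tnth xy.1 ij.1, tnth xy.2 ij.2).
  rewrite sumEFin; congr EFin.
  transitivity (\prod_ij (u ij + (1 - u ij))).
    by rewrite bigA_distr; apply: eq_bigl => E; rewrite inE.
  by rewrite big1// => ij _; rewrite addrC subrK.
by rewrite integral_cst// mul1e [X in fine X](probability_setT (sample_law n)).
Qed.

End random_bipartite_graph.

(* Main.v *)
Require Import Defs.
From HB Require Import structures.
From mathcomp Require Import all_boot all_order all_algebra.
From mathcomp Require Import all_classical all_reals all_analysis ess_sup_inf.
From mathcomp Require Import measurable_realfun.
From mathcomp Require Import ring lra.


(* The upper bound is the first moment method: the expected number of [l x l]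
   bicliques is at most [(n^2 p^l)^l].

   For the lower bound the plain second moment fails, because the number of
   bicliques may be dominated by a few atypical vertices.  Fix [q < sqrt p] and
   [S = {U >= q^2}].  Approximating [S] by finite unions of rectangles gives [A]
   and [B] of positive measure with [S] of density at least [1 - dl] in [A] for
   every [y] in [B].  Hence, for [l] random points of [A], the expected measure
   of their common [S]-neighbourhood in [B] is at least [(1 - dl)^l nu2(B)], so
   with probability at least [(1 - dl)^l / 2] it exceeds half that amount; both
   quantities are only [n^(-small)] when [l = O(log n)].  Choose the left side of
   the biclique uniformly among such good tuples and the right side uniformly in
   the common neighbourhood, with one vertex from each of [l] disjoint blocks of
   about [n / l] vertices.  Two independent choices sharing [a] left and [b] right
   vertices then have weight at most [n^((a + b) (-1 + small))], which beats
   the correlation gain [q^(-2 a b) <= q^(-l (a + b))] as soon as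
   [q^(-l) <= n^(1 - eps)]; the weighted count of bicliques therefore has
   variance tending to [0]. *)

Set Implicit Arguments.
Unset Strict Implicit.
Unset Printing Implicit Defensive.

Import Order.TTheory GRing.Theory Num.Theory.
Import numFieldNormedType.Exports.

Local Open Scope classical_set_scope.
Local Open Scope ring_scope.

(** * Bicliques and edge weights *)

(** Replace [1 - u i] by [0] at the indices of [F] and expand the product of two-term sums over all
    subsets: a set missing an index of [F] contributes [0], the others keep their weight. *)
Lemma sum_edge_weight_superset (R : comNzRingType) (I : finType) (u : I -> R)
    (F : {set I}) :
  \sum_(E : {set I} | F \subset E)
     \prod_i (if i \in E then u i else 1 - u i) = \prod_(i in F) u i.
Proof.
transitivity (\prod_i (u i + (if i \in F then 0 else 1 - u i))).
  rewrite bigA_distr [RHS](bigID [pred E : {set I} | F \subset E])/=.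
  rewrite [X in _ + X]big1 ?addr0 => [|E]; last first.
    rewrite ?inE/= => /subsetPn[i iF iE].
    by rewrite (bigD1 i)//= (negbTE iE) iF mul0r.
  apply: eq_big => [E|E FE] //.
  apply: eq_bigr => i _; case: ifPn => // iE; case: ifPn => // iF.
  by rewrite (fintype.subsetP FE _ iF) in iE.
rewrite [RHS]big_mkcond; apply: eq_bigr => i _.
by case: ifP => _; rewrite ?addr0// addrC subrK.
Qed.

Section biclique_embedding.
Variables (A B : finType) (E : {set A * B}).

Lemma biclique_number_ge_card (X : {set A}) (Y : {set B}) :
  biclique E X Y -> #|X| = #|Y| -> (#|X| <= biclique_number E)%N.
Proof.
move=> XY XYc; rewrite /biclique_number.
by rewrite (bigD1 (X, Y))/= ?XY ?XYc ?eqxx// leq_maxl.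
Qed.

Lemma biclique_number_ge_inj l (f : 'I_l -> A) (g : 'I_l -> B) :
  injective f -> injective g -> (forall i j, (f i, g j) \in E) ->
  (l <= biclique_number E)%N.
Proof.
move=> fI gI fgE; rewrite -(card_ord l) -(card_imset _ fI).
apply: (@biclique_number_ge_card _ [set g j | j in 'I_l]); last first.
  by rewrite !card_imset.
by apply/forall_inP => _ /imsetP[i _ ->]; apply/forall_inP => _ /imsetP[j _ ->].
Qed.

(** Thinning a larger biclique to exactly [l] labelled vertices per side lets the union bound run
    over pairs of maps, which are easier to count than pairs of sets. *)
Lemma biclique_number_inj l : (l <= biclique_number E)%N ->
  exists (f : {ffun 'I_l -> A}) (g : {ffun 'I_l -> B}),
    [/\ injective f, injective g & forall i j, (f i, g j) \in E].
Proof.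
have [[X Y] /andP[/= XY /eqP XYc] ->] : {XY : {set A} * {set B} |
    biclique E XY.1 XY.2 && (#|XY.1| == #|XY.2|) & biclique_number E = #|XY.1|}.
  rewrite /biclique_number.
  apply: (eq_bigmax_cond (fun XY : {set A} * {set B} => #|XY.1|)).
  (* The empty biclique shows that the maximum is over a nonempty family, hence attained. *)
  apply/card_gt0P; exists (finset.set0, finset.set0).
  rewrite unfold_in /= !cards0 eqxx andbT.
  by apply/forall_inP => a; rewrite finset.in_set0.
move=> lX; have lY : (l <= #|Y|)%N by rewrite -XYc.
exists [ffun i => enum_val (widen_ord lX i)].
exists [ffun i => enum_val (widen_ord lY i)].
split=> [i j|i j|i j]; rewrite !ffunE.
- by move=> /enum_val_inj/(congr1 val)/= ij; exact/val_inj.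
- by move=> /enum_val_inj/(congr1 val)/= ij; exact/val_inj.
- by move/forall_inP : XY => /(_ _ (enum_valP _))/forall_inP/(_ _ (enum_valP _)).
Qed.

End biclique_embedding.

(** * Expectations of bounded functions *)

Section probability_of_events.
Context (R : realType) d (T : measurableType d) (P : probability T R).

Definition prob (A : set T) : R := fine (P A).

Lemma probE A : measurable A -> P A = (prob A)%:E.
Proof. by move=> mA; rewrite fineK// fin_num_measure. Qed.

Lemma prob_ge0 A : 0 <= prob A.
Proof. exact: fine_ge0. Qed.

Lemma probT : prob setT = 1.
Proof. by rewrite /prob probability_setT. Qed.

Lemma prob0 : prob set0 = 0.
Proof. by rewrite /prob measure0. Qed.

Lemma le_prob A B : measurable A -> measurable B -> A `<=` B ->
  prob A <= prob B.
Proof.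
by move=> mA mB AB; rewrite -lee_fin -!probE// le_measure// inE.
Qed.

Lemma prob_le1 A : measurable A -> prob A <= 1.
Proof. by move=> mA; rewrite -probT le_prob. Qed.

Lemma prob_leU A B C : measurable A -> measurable B -> measurable C ->
  A `<=` B `|` C -> prob A <= prob B + prob C.
Proof.
move=> mA mB mC ABC; rewrite -lee_fin EFinD -!probE//.
rewrite (le_trans _ (measureU2 _ mB mC))// le_measure ?inE//.
exact: measurableU.
Qed.

Lemma prob_sum (I : finType) (F : I -> set T) (Q : pred I) :
  (forall i, measurable (F i)) ->
  (forall i j, F i `&` F j !=set0 -> i = j) ->
  prob (\bigcup_(i in [set` Q]) F i) = \sum_(i | Q i) prob (F i).
Proof.
move=> mF tF; rewrite /prob measure_fin_bigcup//; last first.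
  by move=> i j _ _; exact: tF.
rewrite -(@bigfs _ _ _ _ (index_enum I) Q)//; last 2 first.
- exact: index_enum_uniq.
- by move=> i; rewrite mem_index_enum.
by rewrite sum_fine// => i _; rewrite fin_num_measure.
Qed.

End probability_of_events.

(** This class is closed under finite sums and products and is integrable for every probability, so
    integrability reduces to closure properties that mention no measure. *)
Definition bounded_measurable (R : realType) d (T : measurableType d)
    (f : T -> R) : Prop :=
  measurable_fun setT f /\ exists M, forall x, `|f x| <= M.

Section bounded_measurable.
Context (R : realType) d (T : measurableType d).
Implicit Types f g : T -> R.

Lemma bounded_measurable_cst (c : R) : bounded_measurable (fun _ : T => c).
Proof. by split=> //; exists `|c|. Qed.

Lemma bounded_measurableD f g : bounded_measurable f -> bounded_measurable g ->
  bounded_measurable (fun x => f x + g x).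
Proof.
move=> [mf [M fM]] [mg [N gN]]; split; first exact: measurable_funD.
by exists (M + N) => x; rewrite (le_trans (ler_normD _ _))// lerD.
Qed.

Lemma bounded_measurableM f g : bounded_measurable f -> bounded_measurable g ->
  bounded_measurable (fun x => f x * g x).
Proof.
move=> [mf [M fM]] [mg [N gN]]; split; first exact: measurable_funM.
by exists (M * N) => x; rewrite normrM ler_pM.
Qed.

Lemma bounded_measurable_sum (I : Type) (s : seq I) (Q : pred I)
    (f : I -> T -> R) : (forall i, bounded_measurable (f i)) ->
  bounded_measurable (fun x => \sum_(i <- s | Q i) f i x).
Proof.
move=> bf; elim: s => [|i s IHs].
  by under eq_fun do rewrite big_nil; exact: bounded_measurable_cst.
under eq_fun do rewrite big_cons.
by case: (Q i) => //; exact: bounded_measurableD.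
Qed.

Lemma bounded_measurable_prod (I : Type) (s : seq I) (Q : pred I)
    (f : I -> T -> R) : (forall i, bounded_measurable (f i)) ->
  bounded_measurable (fun x => \prod_(i <- s | Q i) f i x).
Proof.
move=> bf; elim: s => [|i s IHs].
  by under eq_fun do rewrite big_nil; exact: bounded_measurable_cst.
under eq_fun do rewrite big_cons.
by case: (Q i) => //; exact: bounded_measurableM.
Qed.

Lemma bounded_measurable_indic (A : set T) : measurable A ->
  bounded_measurable (\1_A : T -> R).
Proof.
move=> mA; split; first exact: measurable_indic.
by exists 1 => x; rewrite indicE; case: (x \in A); rewrite ?normr1// normr0.
Qed.

Variable P : probability T R.

Lemma bounded_measurable_integrable f : bounded_measurable f ->
  P.-integrable setT (EFin \o f).
Proof.
move=> [mf [M fM]]; apply: (@le_integrable _ _ _ _ _ _ _ (EFin \o cst M)) => //.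
- exact/measurable_EFinP.
- by move=> x _ /=; rewrite lee_fin (le_trans (fM x))// ler_norm.
- exact: finite_measure_integrable_cst.
Qed.

Lemma expectation_cst (c : R) : \int[P]_x c = c.
Proof. by rewrite Rintegral_cst// -/(prob P setT) probT mulr1. Qed.

Lemma expectationD f g : bounded_measurable f -> bounded_measurable g ->
  \int[P]_x (f x + g x) = \int[P]_x f x + \int[P]_x g x.
Proof.
by move=> bf bg; rewrite RintegralD//; exact: bounded_measurable_integrable.
Qed.

Lemma expectationZ (c : R) f : bounded_measurable f ->
  \int[P]_x (c * f x) = c * \int[P]_x f x.
Proof.
by move=> bf; rewrite RintegralZl//; exact: bounded_measurable_integrable.
Qed.

Lemma expectation_sum (I : Type) (s : seq I) (Q : pred I)
    (f : I -> T -> R) : (forall i, bounded_measurable (f i)) ->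
  \int[P]_x (\sum_(i <- s | Q i) f i x) = \sum_(i <- s | Q i) \int[P]_x f i x.
Proof.
move=> bf; elim: s => [|i s IHs].
  by under eq_Rintegral do rewrite big_nil; rewrite expectation_cst big_nil.
under eq_Rintegral do rewrite big_cons; rewrite big_cons.
case: (Q i) => //; rewrite expectationD ?IHs//.
exact: bounded_measurable_sum.
Qed.

Lemma le_expectation f g : bounded_measurable f -> bounded_measurable g ->
  (forall x, f x <= g x) -> \int[P]_x f x <= \int[P]_x g x.
Proof.
by move=> bf bg fg; apply: le_Rintegral => //; exact: bounded_measurable_integrable.
Qed.

Lemma expectation_indic (A : set T) : measurable A ->
  \int[P]_x (\1_A x : R) = prob P A.
Proof. by move=> mA; rewrite /Rintegral integral_indic// setIT. Qed.

Lemma expectation_le_cst f (c : R) : bounded_measurable f ->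
  (forall x, f x <= c) -> \int[P]_x f x <= c.
Proof.
move=> bf fc; rewrite -[leRHS]expectation_cst; apply: le_expectation => //.
exact: bounded_measurable_cst.
Qed.

End bounded_measurable.

Section bounded_fubini.
Context (R : realType) d1 d2 (T1 : measurableType d1) (T2 : measurableType d2).
Variables (P1 : probability T1 R) (P2 : probability T2 R).
Variables (f : T1 * T2 -> R) (bf : bounded_measurable f).

Lemma bounded_measurable_pair1 x : bounded_measurable (fun y => f (x, y)).
Proof.
move: bf => [mf [M fM]]; split; last by exists M => y.
exact: (measurableT_comp mf (measurable_pair1 x)).
Qed.

Lemma bounded_measurable_pair2 y : bounded_measurable (fun x => f (x, y)).
Proof.
move: bf => [mf [M fM]]; split; last by exists M => x.
exact: (measurableT_comp mf (measurable_pair2 y)).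
Qed.

Let intf := bounded_measurable_integrable (P1 \x P2)%E bf.

Lemma bounded_measurable_expectation1 :
  bounded_measurable (fun x => \int[P2]_y f (x, y)).
Proof.
have mf := @measurable_fubini_F _ _ _ _ _ P1 P2 _ intf.
split; first by apply: measurableT_comp => //; exact: measurable_fine.
have [_ [M fM]] := bf; exists M => x.
have bfx := bounded_measurable_pair1 x.
rewrite ler_norml; apply/andP; split; last first.
  by apply: expectation_le_cst => // y; exact: (le_trans (ler_norm _)).
rewrite -(expectation_cst P2 (- M)); apply: le_expectation => //.
  exact: bounded_measurable_cst.
by move=> y; have := fM (x, y); rewrite ler_norml => /andP[].
Qed.

Lemma bounded_measurable_expectation2 :
  bounded_measurable (fun y => \int[P1]_x f (x, y)).
Proof.
have mf := @measurable_fubini_G _ _ _ _ _ P1 P2 _ intf.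
split; first by apply: measurableT_comp => //; exact: measurable_fine.
have [_ [M fM]] := bf; exists M => y.
have bfy := bounded_measurable_pair2 y.
rewrite ler_norml; apply/andP; split; last first.
  by apply: expectation_le_cst => // x; exact: (le_trans (ler_norm _)).
rewrite -(expectation_cst P1 (- M)); apply: le_expectation => //.
  exact: bounded_measurable_cst.
by move=> x; have := fM (x, y); rewrite ler_norml => /andP[].
Qed.

Lemma expectation_prod1 :
  \int[(P1 \x P2)%E]_z f z = \int[P1]_x \int[P2]_y f (x, y).
Proof.
rewrite /Rintegral -integral12_prod_meas1//; congr fine.
apply: eq_integral => x _; rewrite /fubini_F/= fineK//.
apply: integrable_fin_num => //; apply: bounded_measurable_integrable.
exact: bounded_measurable_pair1.
Qed.

Lemma expectation_prod2 :
  \int[(P1 \x P2)%E]_z f z = \int[P2]_y \int[P1]_x f (x, y).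
Proof.
rewrite /Rintegral -integral21_prod_meas1//; congr fine.
apply: eq_integral => y _; rewrite /fubini_G/= fineK//.
apply: integrable_fin_num => //.
exact: (bounded_measurable_integrable P1 (bounded_measurable_pair2 y)).
Qed.

End bounded_fubini.

Section prob_sections.
Context (R : realType) d1 d2 (T1 : measurableType d1) (T2 : measurableType d2).
Variables (P1 : probability T1 R) (P2 : probability T2 R).
Variables (S : set (T1 * T2)) (mS : measurable S).

Let bS := bounded_measurable_indic R mS.

Let E1 x : \int[P2]_y (\1_S (x, y) : R) = prob P2 (xsection S x).
Proof.
rewrite -expectation_indic; last exact: measurable_xsection.
by apply: eq_Rintegral => y _; rewrite !indicE mem_xsection.
Qed.

Let E2 y : \int[P1]_x (\1_S (x, y) : R) = prob P1 (ysection S y).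
Proof.
rewrite -expectation_indic; last exact: measurable_ysection.
by apply: eq_Rintegral => x _; rewrite !indicE mem_ysection.
Qed.

Lemma bounded_measurable_xsection :
  bounded_measurable (fun x => prob P2 (xsection S x)).
Proof.
by under eq_fun do rewrite -E1; exact: (bounded_measurable_expectation1 P1).
Qed.

Lemma bounded_measurable_ysection :
  bounded_measurable (fun y => prob P1 (ysection S y)).
Proof.
by under eq_fun do rewrite -E2; exact: (bounded_measurable_expectation2 P1 P2).
Qed.

Lemma prob_xsection :
  prob (P1 \x P2)%E S = \int[P1]_x prob P2 (xsection S x).
Proof.
rewrite -expectation_indic// expectation_prod1//.
by apply: eq_Rintegral => x _; rewrite E1.
Qed.

Lemma prob_ysection :
  prob (P1 \x P2)%E S = \int[P2]_y prob P1 (ysection S y).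
Proof.
rewrite -expectation_indic// expectation_prod2//.
by apply: eq_Rintegral => y _; rewrite E2.
Qed.

End prob_sections.

(** * Dense rectangles *)

Section rectangle_approximation.
Context (R : realType) d1 d2 (T1 : measurableType d1) (T2 : measurableType d2).
Variables (nu1 : probability T1 R) (nu2 : probability T2 R).
Local Notation mu := (nu1 \x nu2)%E.

(* A finite union of rectangles, presented by finite measurable colourings of
   both factors so that complements and unions are immediate. *)
Definition rectangle_union (D : set (T1 * T2)) : Prop :=
  exists (I1 I2 : finType) (f1 : T1 -> I1) (f2 : T2 -> I2) (Q : pred (I1 * I2)),
    [/\ forall i, measurable (f1 @^-1` [set i]),
        forall i, measurable (f2 @^-1` [set i])
      & D = [set z | Q (f1 z.1, f2 z.2)]].

Lemma rectangle_unionE (I1 I2 : finType) (f1 : T1 -> I1) (f2 : T2 -> I2)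
    (Q : pred (I1 * I2)) :
  [set z | Q (f1 z.1, f2 z.2)] =
  \bigcup_(q in [set` Q]) (f1 @^-1` [set q.1] `*` f2 @^-1` [set q.2]).
Proof.
apply/seteqP; split=> z /=; first by move=> Qz; exists (f1 z.1, f2 z.2).
by case=> q Qq [/= -> ->]; rewrite -surjective_pairing.
Qed.

Lemma measurable_rectangle_union D : rectangle_union D -> measurable D.
Proof.
move=> [I1 [I2 [f1 [f2 [Q [m1 m2 ->]]]]]]; rewrite (rectangle_unionE f1 f2 Q).
by apply: fin_bigcup_measurable => // q _; exact: measurableX.
Qed.

Lemma rectangle_unionC D : rectangle_union D -> rectangle_union (~` D).
Proof.
move=> [I1 [I2 [f1 [f2 [Q [m1 m2 ->]]]]]].
exists I1, I2, f1, f2, (predC Q); split=> //.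
by apply/seteqP; split=> z /= /negP.
Qed.

Lemma rectangle_unionU D E :
  rectangle_union D -> rectangle_union E -> rectangle_union (D `|` E).
Proof.
move=> [I1 [I2 [f1 [f2 [Q [m1 m2 ->]]]]]] [J1 [J2 [g1 [g2 [Q' [m1' m2' ->]]]]]].
exists (I1 * J1)%type, (I2 * J2)%type.
exists (fun x => (f1 x, g1 x)), (fun x => (f2 x, g2 x)).
exists (fun q => Q (q.1.1, q.2.1) || Q' (q.1.2, q.2.2)); split.
- move=> [i j]; rewrite (_ : _ @^-1` _ = f1 @^-1` [set i] `&` g1 @^-1` [set j]).
    exact: measurableI.
  by apply/seteqP; split=> x /= [-> ->].
- move=> [i j]; rewrite (_ : _ @^-1` _ = f2 @^-1` [set i] `&` g2 @^-1` [set j]).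
    exact: measurableI.
  by apply/seteqP; split=> x /= [-> ->].
- by apply/seteqP; split=> z /= /orP.
Qed.

(** Measurability is bundled in so that it is carried along by the induction over the generated
    sigma-algebra. *)
Definition rectangle_approx (S : set (T1 * T2)) : Prop :=
  measurable S /\ forall e : R, 0 < e -> exists2 D, rectangle_union D &
    prob mu ((S `\` D) `|` (D `\` S)) < e.

Lemma rectangle_approxU S S' :
  rectangle_approx S -> rectangle_approx S' -> rectangle_approx (S `|` S').
Proof.
move=> [mS aS] [mS' aS']; split; first exact: measurableU.
move=> e e0; have e20 : 0 < e / 2 by lra.
have [D rD De] := aS _ e20; have [D' rD' De'] := aS' _ e20.
exists (D `|` D'); first exact: rectangle_unionU.
have mD := measurable_rectangle_union rD.
have mD' := measurable_rectangle_union rD'.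
suff : prob mu ((S `|` S') `\` (D `|` D') `|` (D `|` D') `\` (S `|` S')) <=
  prob mu (S `\` D `|` D `\` S) + prob mu (S' `\` D' `|` D' `\` S') by lra.
apply: prob_leU; try by apply: measurableU; apply: measurableD;
  rewrite //; apply: measurableU.
move=> z /= [[[Sz|Sz] /not_orP[Dz Dz']]|[[Dz|Dz] /not_orP[Sz Sz']]].
- by left; left.
- by right; left.
- by left; right.
- by right; right.
Qed.

(** The approximable sets form a sigma-algebra containing the rectangles: complements keep the
    symmetric difference, and a countable union is close to a finite partial union. *)
Lemma measurable_rectangle_approx S : measurable S -> rectangle_approx S.
Proof.
rewrite measurable_prod_measurableType; apply: smallest_sub; last first.
  move=> _ [A mA [B mB <-]]; split; first exact: measurableX.
  move=> e e0; exists (A `*` B); last by rewrite setDv setU0 prob0.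
  exists bool, bool, (fun x => x \in A), (fun y => y \in B).
  exists (fun q => q.1 && q.2); split.
  - move=> [].
      by rewrite (_ : _ @^-1` _ = A)//; apply/seteqP; split=> x /=;
        [move/set_mem|move/mem_set].
    rewrite (_ : _ @^-1` _ = ~` A); first exact: measurableC.
    apply/seteqP; split=> x /=; first by move=> xA /mem_set; rewrite xA.
    by move=> xA; apply/negP => /set_mem.
  - move=> [].
      by rewrite (_ : _ @^-1` _ = B)//; apply/seteqP; split=> x /=;
        [move/set_mem|move/mem_set].
    rewrite (_ : _ @^-1` _ = ~` B); first exact: measurableC.
    apply/seteqP; split=> x /=; first by move=> xA /mem_set; rewrite xA.
    by move=> xA; apply/negP => /set_mem.
  - apply/seteqP; split=> z /=; first by move=> [/mem_set -> /mem_set ->].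
    by move=> /andP[/set_mem ? /set_mem].
have a0 : rectangle_approx set0.
  split=> // e e0; exists set0; last by rewrite setDv setU0 prob0.
  exists unit, unit, (fun=> tt), (fun=> tt), xpred0.
  by split=> [i|i|]; [rewrite preimage_cst; case: ifP..|apply/seteqP; split].
split=> //.
  move=> A [mA aA]; rewrite setTD; split; first exact: measurableC.
  move=> e /aA[D rD De]; exists (~` D); first exact: rectangle_unionC.
  by rewrite !setDE !setCK setUC setIC [X in _ `|` X]setIC -!setDE.
move=> F aF; have mF n : measurable (F n) by have [] := aF n.
have mUF : measurable (\bigcup_k F k) by exact: bigcup_measurable.
split=> // e e0; have e20 : 0 < e / 2 by lra.
pose G n := \big[setU/set0]_(k < n.+1) F k.
have aG n : rectangle_approx (G n).
  elim: n => [|n IHn]; first by rewrite /G big_ord1.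
  by rewrite /G big_ord_recr/=; exact: rectangle_approxU.
have mG n : measurable (G n) by have [] := aG n.
have UG : \bigcup_n G n = \bigcup_n F n.
  exact: bigcup_bigsetU_bigcup.
have GU n : G n `<=` \bigcup_n F n by rewrite -UG; exact: bigcup_sup.
(* Continuity from below along the increasing partial unions [G n]. *)
have [n ne] : exists n, prob mu (\bigcup_n F n `\` G n) < e / 2.
  have : (prob mu \o G) n @[n --> \oo] --> prob mu (\bigcup_n F n).
    rewrite -UG; apply: fine_cvg; rewrite -probE; last by rewrite UG.
    apply: nondecreasing_cvg_mu => //; first by rewrite UG.
    by move=> m n mn; apply/subsetPset; exact: subset_bigsetU.
  move/cvgrPdist_lt => /(_ _ e20)[n _ /(_ n (leqnn n))/= ne]; exists n.
  have : prob mu (\bigcup_n F n) = prob mu (G n) + prob mu (\bigcup_n F n `\` G n).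
    apply: EFin_inj; rewrite EFinD -!probE//; last exact: measurableD.
    rewrite -measureU//; last 2 first.
    - exact: measurableD.
    - by rewrite setDIK.
    by rewrite setDUK.
  by move: ne; rewrite ltr_norml; lra.
have [_ /(_ _ e20)[D rD De]] := aG n; exists D => //.
have mD := measurable_rectangle_union rD.
suff : prob mu (\bigcup_k F k `\` D `|` D `\` \bigcup_k F k) <=
    prob mu (\bigcup_k F k `\` G n) + prob mu (G n `\` D `|` D `\` G n).
  by lra.
apply: prob_leU.
- by apply: measurableU; apply: measurableD.
- exact: measurableD.
- by apply: measurableU; apply: measurableD.
move=> z /= [[Fz Dz]|[Dz Fz]].
  have [Gz|Gz] := pselect (G n z); last by left.
  by right; left.
by right; right; split=> // /GU.
Qed.

(** Otherwise [S] has density at most [1 - dl] in every cell of an approximating union [D]. The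
    cells are disjoint, so the same bound holds in [D], which contradicts that [D] is close to
    [S]. *)
Lemma dense_rectangle (S : set (T1 * T2)) (dl : R) :
  measurable S -> 0 < prob mu S -> 0 < dl <= 1 ->
  exists A B, [/\ measurable A, measurable B &
    (1 - dl) * prob mu (A `*` B) < prob mu (S `&` (A `*` B))].
Proof.
move=> mS S0 /andP[dl0 dl1]; have [_ aS] := measurable_rectangle_approx mS.
(* With error [f], the density bound gives [dl * mu D <= f], while [mu D >= mu S - f]; hence
   [dl * mu S <= 2 * f], which an error below [mu S * dl / 4] excludes. *)
have e0 : 0 < prob mu S * dl / 4 by rewrite divr_gt0// mulr_gt0.
have [D rD De] := aS _ e0; have mD := measurable_rectangle_union rD.
have [I1 [I2 [f1 [f2 [Q [m1 m2 DE]]]]]] := rD.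
pose C (q : I1 * I2) := f1 @^-1` [set q.1] `*` f2 @^-1` [set q.2].
have mC q : measurable (C q) by exact: measurableX.
apply: contrapT => noAB.
have SC q : prob mu (S `&` C q) <= (1 - dl) * prob mu (C q).
  rewrite leNgt; apply/negP => SC; apply: noAB.
  by exists (f1 @^-1` [set q.1]), (f2 @^-1` [set q.2]).
have DC : D = \bigcup_(q in [set` Q]) C q by rewrite DE (rectangle_unionE f1 f2 Q).
have tC q q' : C q `&` C q' !=set0 -> q = q'.
  by case: q q' => [a b] [a' b'] [z [[/= <- <-] [/= <- <-]]].
have SD : prob mu (S `&` D) <= (1 - dl) * prob mu D.
  rewrite {1}DC setI_bigcupr prob_sum; last 2 first.
  - by move=> q; exact: measurableI.
  - by move=> q q' [z [[_ Cz] [_ C'z]]]; apply: tC; exists z.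
  rewrite [in leRHS]DC prob_sum// mulr_sumr; exact: ler_sum.
have mSD : measurable ((S `\` D) `|` (D `\` S)).
  by apply: measurableU; apply: measurableD.
have : prob mu D <= prob mu (S `&` D) + prob mu ((S `\` D) `|` (D `\` S)).
  apply: prob_leU => //; first exact: measurableI.
  by move=> z Dz; have [Sz|Sz] := pselect (S z); [left|right; right].
have : prob mu S <= prob mu (S `&` D) + prob mu ((S `\` D) `|` (D `\` S)).
  apply: prob_leU => //; first exact: measurableI.
  by move=> z Sz; have [Dz|Dz] := pselect (D z); [left|right; left].
have := prob_ge0 mu D.
move: SD De S0; set a := prob mu (S `&` D); set b := prob mu D.
set c := prob mu S; set f := prob mu (_ `|` _) => SD De S0 b0 h1 h2.
rewrite mulrBl mul1r in SD.
have h3 : dl * b <= f by lra.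
have h4 : c - f <= b.
  have : 0 <= dl * b by rewrite mulr_ge0// ltW.
  by lra.
have h5 : dl * (c - f) <= f.
  by rewrite (le_trans _ h3)// ler_wpM2l// ltW.
have h6 : 0 < c * dl by exact: mulr_gt0.
have h7 : dl * f <= f by rewrite ler_piMl// prob_ge0.
by rewrite mulrBr [dl * c]mulrC in h5; lra.
Qed.

End rectangle_approximation.

(** Upgrades average density in a rectangle to density in every section: if the dense sections
    formed a null set, integrating over [B] would bound the density of [S] in the rectangle by
    [1 - dl]. *)
Lemma dense_sections (R : realType) d1 d2
    (T1 : measurableType d1) (T2 : measurableType d2)
    (nu1 : probability T1 R) (nu2 : probability T2 R)
    (S : set (T1 * T2)) (dl : R) :
  measurable S -> 0 < prob (nu1 \x nu2)%E S -> 0 < dl <= 1 ->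
  exists A B, [/\ measurable A, measurable B, 0 < prob nu1 A, 0 < prob nu2 B &
    forall y, B y -> (1 - dl) * prob nu1 A <= prob nu1 (A `&` ysection S y)].
Proof.
move=> mS S0 dl01; have [A [B [mA mB AB]]] := dense_rectangle mS S0 dl01.
(* [SA] serves to define [B'] and to prove it measurable; [SAB], also cut down to [B], is the set
   whose measure is integrated. *)
have [dl0 dl1] := andP dl01.
pose SA := S `&` (A `*` setT); pose SAB := S `&` (A `*` B).
have mSA : measurable SA by apply: measurableI => //; exact: measurableX.
have mSAB : measurable SAB by apply: measurableI => //; exact: measurableX.
have SAE y : ysection SA y = A `&` ysection S y.
  apply/seteqP; split=> x /=.
    by move=> /set_mem[xyS [xA _]]; split=> //; exact: mem_set.
  by move=> [xA /set_mem xyS]; apply: mem_set; split.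
have prAB : prob (nu1 \x nu2)%E (A `*` B) = prob nu1 A * prob nu2 B.
  by rewrite /prob [X in fine X](product_measure1E nu1 nu2)// fineM// fin_num_measure.
have : prob (nu1 \x nu2)%E SAB <= prob (nu1 \x nu2)%E (A `*` B).
  by apply: le_prob => // [|z []//]; exact: measurableX.
(* The strict inequality for the dense rectangle forces its measure to be positive. *)
move=> /(lt_le_trans AB); rewrite mulrBl mul1r ltrBlDr ltrDl => AB0.
have {}AB0 : 0 < prob nu1 A * prob nu2 B.
  by move: AB0; rewrite pmulr_rgt0// prAB.
have a0 : 0 < prob nu1 A.
  rewrite lt0r prob_ge0 andbT; apply/negP => /eqP a0.
  by move: AB0; rewrite a0 mul0r ltxx.
have bA := bounded_measurable_ysection nu1 nu2 mSA.
pose B' := B `&` [set y | (1 - dl) * prob nu1 A <= prob nu1 (ysection SA y)].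
have mB' : measurable B'.
  apply: measurableI => //; rewrite -[X in measurable X]setTI.
  by apply: measurable_fun_le => //; exact: bA.1.
exists A, B'; split=> //; last by move=> y [_ /=]; rewrite SAE.
rewrite lt0r prob_ge0 andbT; apply/negP => /eqP B'0.
(* Pointwise in [y], the section has measure at most [nu1 A] on [B'], at most [(1 - dl) * nu1 A] on
   the rest of [B], and is empty outside [B]. *)
suff : prob (nu1 \x nu2)%E SAB <=
    prob nu1 A * prob nu2 B' + (1 - dl) * prob nu1 A * prob nu2 B.
  by rewrite B'0 mulr0 add0r -mulrA -prAB leNgt AB.
rewrite prob_ysection// -(expectation_indic nu2 mB') -(expectation_indic nu2 mB).
have bB' := bounded_measurable_indic R mB'.
have bB := bounded_measurable_indic R mB.
have bc c := bounded_measurable_cst T2 (c : R).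
rewrite -!expectationZ// -expectationD; last 2 first.
- exact: bounded_measurableM.
- exact: bounded_measurableM.
apply: le_expectation => [||y].
- exact: (bounded_measurable_ysection nu1 nu2).
- by apply: bounded_measurableD; apply: bounded_measurableM.
have yA : prob nu1 (ysection SAB y) <= prob nu1 A.
  apply: le_prob => //; first exact: measurable_ysection.
  by move=> x /set_mem[_ []].
have c0 : 0 <= (1 - dl) * prob nu1 A by rewrite mulr_ge0 ?prob_ge0 ?subr_ge0.
have [yB|yB] := pselect (B y); last first.
  rewrite (_ : ysection _ _ = set0) ?prob0; last first.
    by apply/seteqP; split=> x // /set_mem[_ []].
  by rewrite addr_ge0// mulr_ge0// ?prob_ge0 ?indicE//.
have [yB'|yB'] := pselect (B' y).
  rewrite [\1_B' y]indicE mem_set// mulr1 (le_trans yA)// lerDl.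
  by rewrite mulr_ge0// indicE.
rewrite [X in _ + _ * X]indicE mem_set// mulr1 [\1_B' y]indicE memNset// mulr0 add0r.
have -> : ysection SAB y = ysection SA y.
  apply/seteqP; split=> x /set_mem; rewrite /SA /SAB => -[xS [xA _]];
    by apply: mem_set; split.
by rewrite leNgt; apply/negP => /ltW yS; exact: yB'.
Qed.

(** * Marginals of i.i.d. samples *)

Section iid_marginals.
Context (R : realType) d (T : measurableType d) (P : probability T R).

Definition tuple_select n l (X : 'I_l -> 'I_n) (t : n.-tuple T) : l.-tuple T :=
  [tuple tnth t (X i) | i < l].

Lemma measurable_tuple_select n l (X : 'I_l -> 'I_n) :
  measurable_fun setT (tuple_select X).
Proof.
apply/measurable_fun_tnthP => i; rewrite (_ : _ \o _ = @tnth n T ^~ (X i)).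
  exact: measurable_tnth.
by apply/funext => t /=; rewrite tnth_mktuple.
Qed.

HB.instance Definition _ n l (X : 'I_l -> 'I_n) :=
  isMeasurableFun.Build _ _ _ _ (tuple_select X) (measurable_tuple_select X).

Lemma measurable_box n (K : finType) (Z : K -> 'I_n) (A : K -> set T) :
  (forall k, measurable (A k)) ->
  measurable [set t : n.-tuple T | forall k, A k (tnth t (Z k))].
Proof.
move=> mA; rewrite (_ : mkset _ = \bigcap_(k in [set: K])
    ((@tnth n T)^~ (Z k) @^-1` (A k))).
  apply: fin_bigcap_measurable => // k _.
  by rewrite -[X in measurable X]setTI; exact: measurable_tnth.
by apply/seteqP; split => t /= At i => [_|]; exact: At.
Qed.

(** Regroup the constraints by coordinate: by injectivity each coordinate carries at most one, and
    unconstrained coordinates contribute [1]. *)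
Lemma iid_boxE n (K : finType) (Z : K -> 'I_n) (A : K -> set T) :
  injective Z -> (forall k, measurable (A k)) ->
  (iid P n [set t | forall k, A k (tnth t (Z k))] = \prod_k P (A k))%E.
Proof.
move=> ZI mA; pose B i := [set x | forall k, Z k = i -> A k x].
have BZ k : B (Z k) = A k.
  by apply/seteqP; split=> x /= => [/(_ _ erefl)//|Ax j /ZI ->].
have BN i : i \notin imset Z (mem K) -> B i = setT.
  move=> iZ; apply/seteqP; split=> x //= _ k ki.
  by move/negP : iZ; case; rewrite -ki imset_f.
have mB i : measurable (B i).
  have [/imsetP[k _ ->]|iZ] := boolP (i \in imset Z (mem K)).
    by rewrite BZ.
  by rewrite BN.
rewrite (_ : mkset _ = [set t | forall i, B i (tnth t i)]); last first.
  by apply/seteqP; split=> t /= => [At i k <-|Bt k]; [exact: At|exact: Bt].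
rewrite iidE// (bigID (mem (imset Z (mem K))))/=.
rewrite [X in (_ * X)%E]big1 ?mule1 => [|i iZ]; last by rewrite BN// probability_setT.
by rewrite big_imset/=; [apply: eq_bigr => k _; rewrite BZ|move=> i j _ _; exact: ZI].
Qed.

(** Boxes form a generating pi-system. The factor [c] allows for pushforwards of the law restricted
    to an event, whose total mass need not be [1]; independence is derived from this. *)
Lemma iid_unique n (c : {nonneg R}) (m : {measure set (n.-tuple T) -> \bar R}) :
  (forall A : 'I_n -> set T, (forall i, measurable (A i)) ->
    m [set t | forall i, A i (tnth t i)] = c%:num%:E * \prod_i P (A i))%E ->
  forall C, measurable C -> (m C = c%:num%:E * iid P n C)%E.
Proof.
move=> mE C mC.
pose G : set (set (n.-tuple T)) := [set D | exists2 A : 'I_n -> set T,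
  (forall i, measurable (A i)) & D = [set t | forall i, A i (tnth t i)]].
have GT : G setT.
  exists (fun=> setT) => [i|]; first exact: measurableT.
  by apply/seteqP; split.
rewrite -/(mscale c (iid P n) C).
apply: (measure_unique G (fun=> setT)) => //=.
- apply/seteqP; split.
    apply: smallest_sub; first exact: smallest_sigma_algebra.
    rewrite -bigcup_seq => D [i /= _ [A mA] <-].
    apply: sub_sigma_algebra; exists (fun j => if j == i then A else setT).
      by move=> j; case: ifP.
    apply/seteqP; split=> t /=; first by move=> [_ At] j; case: eqP => // ->.
    by move=> /(_ i); rewrite eqxx.
  apply: smallest_sub; first exact: sigma_algebra_measurable.
  by move=> _ [A mA ->]; exact: measurable_box.
- move=> _ _ [A mA ->] [B mB ->]; exists (fun i => A i `&` B i).
    by move=> i; exact: measurableI.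
  apply/seteqP; split=> t /=; first by move=> [At Bt] i.
  by move=> ABt; split=> i; have [] := ABt i.
- by apply/seteqP; split=> // t _; exists 0%N.
- by move=> _ [A mA ->]; rewrite mE// /mscale/= iidE.
- move=> _; have := mE (fun=> setT) (fun=> measurableT).
  rewrite (_ : mkset _ = setT); last by apply/seteqP; split.
  by move=> ->; rewrite big1 ?mule1 ?ltry// => i _; rewrite probability_setT.
Qed.

(** Restrict the law to the box event on the coordinates [X'] and push it forward along the
    selection [X]: on boxes this is a constant multiple of the [l]-fold law, hence everywhere. *)
Lemma iid_select_box n l (X : 'I_l -> 'I_n) (J : finType) (X' : J -> 'I_n)
    (C : set (l.-tuple T)) (A : J -> set T) :
  injective X -> injective X' -> (forall i j, X i != X' j) ->
  measurable C -> (forall j, measurable (A j)) ->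
  (iid P n [set t | C (tuple_select X t) /\ forall j, A j (tnth t (X' j))] =
   \prod_j P (A j) * iid P l C)%E.
Proof.
move=> XI X'I XX' mC mA.
pose D := [set t : n.-tuple T | forall j, A j (tnth t (X' j))].
have mD : measurable D by exact: measurable_box.
have cE : (\prod_j P (A j) = (\prod_j fine (P (A j)))%:E)%E.
  by rewrite -prodEFin; apply: eq_bigr => j _; rewrite fineK// fin_num_measure.
have c0 : 0 <= \prod_j fine (P (A j)).
  by apply: prodr_ge0 => j _; rewrite fine_ge0.
rewrite cE -[X in (X%:E * _)%E]/((NngNum c0)%:num).
rewrite -(@iid_unique l (NngNum c0)
  [the measure _ _ of pushforward (mrestr (iid P n) mD) (tuple_select X)])//.
move=> B mB; rewrite /= /pushforward /mrestr/=.
(* The two disjoint families of coordinates become one injective family, so the intersection is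
   again a box. *)
pose Z (k : 'I_l + J) := match k with inl i => X i | inr j => X' j end.
pose F (k : 'I_l + J) := match k with inl i => B i | inr j => A j end.
have ZI : injective Z.
  move=> [i|j] [i'|j'] /=.
  - by move=> /XI ->.
  - by move=> e; have := XX' i j'; rewrite e eqxx.
  - by move=> e; have := XX' i' j; rewrite e eqxx.
  - by move=> /X'I ->.
rewrite (_ : _ `&` _ = [set t | forall k, F k (tnth t (Z k))]); last first.
  apply/seteqP; split=> t /=.
    move=> [Bt At] [i|j] /=; last exact: At.
    by have := Bt i; rewrite tnth_mktuple.
  move=> Ft; split=> [i|j]; last exact: (Ft (inr j)).
  by rewrite tnth_mktuple; exact: (Ft (inl i)).
rewrite iid_boxE//; last by case.
by rewrite big_sumType/= muleC cE.
Qed.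

Lemma iid_select n l (X : 'I_l -> 'I_n) (C : set (l.-tuple T)) :
  injective X -> measurable C ->
  (iid P n [set t | C (tuple_select X t)] = iid P l C)%E.
Proof.
move=> XI mC.
have := @iid_select_box n l X 'I_0 (widen_ord (leq0n n)) C (fun=> setT) XI.
rewrite big_ord0 mul1e => <-//; [|by case|by move=> i []].
by congr (iid P n _); apply/seteqP; split=> t //= -[].
Qed.

(** Same argument, now restricting to the event [C]; the boxes on the coordinates [X'] are handled
    by [iid_select_box]. *)
Lemma iid_select2 n l l' (X : 'I_l -> 'I_n) (X' : 'I_l' -> 'I_n)
    (C : set (l.-tuple T)) (C' : set (l'.-tuple T)) :
  injective X -> injective X' -> (forall i j, X i != X' j) ->
  measurable C -> measurable C' ->
  (iid P n [set t | C (tuple_select X t) /\ C' (tuple_select X' t)] =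
   iid P l C * iid P l' C')%E.
Proof.
move=> XI X'I XX' mC mC'.
pose D := [set t : n.-tuple T | C (tuple_select X t)].
have mD : measurable D.
  by rewrite -[D]setTI; exact: measurable_tuple_select.
have c0 : 0 <= fine (iid P l C) by rewrite fine_ge0.
have cE : iid P l C = ((NngNum c0)%:num)%:E.
  by rewrite /= fineK// fin_num_measure.
rewrite cE -(@iid_unique l' (NngNum c0)
  [the measure _ _ of pushforward (mrestr (iid P n) mD) (tuple_select X')])//.
  by rewrite /= /pushforward /mrestr setIC.
move=> B mB; rewrite -cE muleC -(iid_select_box XI X'I)//.
rewrite /= /pushforward /mrestr setIC; congr (iid P n _).
apply/seteqP; split=> t /= [Ct Bt]; split=> // i.
  by have := Bt i; rewrite tnth_mktuple.
by rewrite tnth_mktuple.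
Qed.

End iid_marginals.

(** * First moment *)

Section edge_expectation.
Context (R : realType) d1 d2 (T1 : measurableType d1) (T2 : measurableType d2).
Variables (nu1 : probability T1 R) (nu2 : probability T2 R) (U : T1 * T2 -> R).
Hypothesis hU : bigraphon U.

Lemma bounded_measurable_edge n (i j : 'I_n) :
  bounded_measurable
    (fun xy : n.-tuple T1 * n.-tuple T2 => U (tnth xy.1 i, tnth xy.2 j)).
Proof.
have [mU U01] := hU; split; last first.
  by exists 1 => xy; have /andP[U0 U1] := U01 (tnth xy.1 i, tnth xy.2 j);
    rewrite ger0_norm.
apply: (@measurableT_comp _ _ _ _ _ _ U) => //.
apply: measurable_fun_pair.
  exact: (measurableT_comp (measurable_tnth i) measurable_fst).
exact: (measurableT_comp (measurable_tnth j) measurable_snd).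
Qed.

Lemma bounded_measurable_edge_set_weight n (E : {set 'I_n * 'I_n}) :
  bounded_measurable (fun xy : n.-tuple T1 * n.-tuple T2 =>
    edge_set_weight U E xy.1 xy.2).
Proof.
apply: bounded_measurable_prod => ij /=; case: (ij \in E).
  exact: bounded_measurable_edge.
have [mu [M uM]] := bounded_measurable_edge ij.1 ij.2; split.
  exact: measurable_funB.
exists (1 + M) => xy; rewrite (le_trans (ler_normB _ _))// normr1 lerD2l.
exact: uM.
Qed.

Lemma edge_set_weight_ge0 n (E : {set 'I_n * 'I_n}) x y :
  0 <= edge_set_weight U E x y.
Proof.
apply: prodr_ge0 => ij _ /=.
by have := hU.2 (tnth x ij.1, tnth y ij.2); case: ifP => _; lra.
Qed.

Lemma edge_set_weight_superset n (F : {set 'I_n * 'I_n}) x y :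
  \sum_(E : {set 'I_n * 'I_n} | F \subset E) edge_set_weight U E x y =
  \prod_(ij in F) U (tnth x ij.1, tnth y ij.2).
Proof. exact: sum_edge_weight_superset. Qed.

Definition bigraphon_cond_pr n (Q : pred {set 'I_n * 'I_n})
    (xy : n.-tuple T1 * n.-tuple T2) : R :=
  \sum_(E | Q E) edge_set_weight U E xy.1 xy.2.

Lemma bounded_measurable_cond_pr n (Q : pred {set 'I_n * 'I_n}) :
  bounded_measurable (@bigraphon_cond_pr n Q).
Proof.
by apply: bounded_measurable_sum => E; exact: bounded_measurable_edge_set_weight.
Qed.

Lemma bigraphon_prE n (Q : pred {set 'I_n * 'I_n}) :
  bigraphon_pr nu1 nu2 U Q =
  \int[sample_law nu1 nu2 n]_xy bigraphon_cond_pr Q xy.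
Proof.
rewrite expectation_sum// => E; exact: bounded_measurable_edge_set_weight.
Qed.

Lemma bigraphon_pr_ge0 n (Q : pred {set 'I_n * 'I_n}) :
  0 <= bigraphon_pr nu1 nu2 U Q.
Proof.
rewrite bigraphon_prE; apply: Rintegral_ge0 => xy _.
by apply: sumr_ge0 => E _; exact: edge_set_weight_ge0.
Qed.

Lemma bigraphon_prC n (Q : pred {set 'I_n * 'I_n}) :
  bigraphon_pr nu1 nu2 U Q = 1 - bigraphon_pr nu1 nu2 U (predC Q).
Proof.
rewrite -(bigraphon_pr_total nu1 nu2 n hU) /bigraphon_pr.
by rewrite [X in X - _](bigID Q)/= addrK.
Qed.

Lemma bigraphon_pr_leU n (Q Q1 Q2 : pred {set 'I_n * 'I_n}) :
  (forall E, Q E -> Q1 E || Q2 E) ->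
  bigraphon_pr nu1 nu2 U Q <=
  bigraphon_pr nu1 nu2 U Q1 + bigraphon_pr nu1 nu2 U Q2.
Proof.
move=> QQ; rewrite /bigraphon_pr (big_mkcond Q) (big_mkcond Q1) (big_mkcond Q2).
rewrite -big_split/=.
apply: ler_sum => E _.
have : 0 <= bigraphon_pmf nu1 nu2 U E.
  by apply: Rintegral_ge0 => xy _; exact: edge_set_weight_ge0.
have := QQ E; case: (Q E) => [/(_ isT)/orP[->|->]|_] w0.
- by case: ifP => _; lra.
- by case: ifP => _; lra.
- by do 2 case: ifP => _; lra.
Qed.

(** Transfers null sets of the product space to the samples. Both sides are measures in [D] that
    agree on rectangles, so the product measure is determined. *)
Lemma sample_edge_law n (i j : 'I_n) (D : set (T1 * T2)) : measurable D ->
  prob (sample_law nu1 nu2 n) [set xy | D (tnth xy.1 i, tnth xy.2 j)] =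
  prob (nu1 \x nu2)%E D.
Proof.
move=> mD; pose h (xy : n.-tuple T1 * n.-tuple T2) := (tnth xy.1 i, tnth xy.2 j).
have mh : measurable_fun setT h.
  apply: measurable_fun_pair.
    exact: (measurableT_comp (measurable_tnth i) measurable_fst).
  exact: (measurableT_comp (measurable_tnth j) measurable_snd).
pose hh : {mfun _ >-> _} := HB.pack h (isMeasurableFun.Build _ _ _ _ h mh).
have mtn dd (T : measurableType dd) (k : 'I_n) (A : set T) : measurable A ->
    measurable [set t : n.-tuple T | A (tnth t k)].
  by move=> mA; rewrite -[X in measurable X]setTI; exact: measurable_tnth.
have iid1 dd (T : measurableType dd) (P : probability T R) (k : 'I_n) A :
    measurable A -> iid P n [set t | A (tnth t k)] = P A.
  move=> mA.
  have := @iid_boxE R dd T P n 'I_1 (fun=> k) (fun=> A).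
  rewrite big_ord1 => <-//; last by move=> a b _; rewrite !ord1.
  by congr (iid P n _); apply/seteqP; split=> t /=; [|apply; exact: ord0].
suff E : ((nu1 \x nu2)%E D = pushforward (sample_law nu1 nu2 n) hh D)%E.
  exact: (congr1 fine (esym E)).
apply: (@product_measure_unique _ _ _ _ _ nu1 nu2
  [the measure _ _ of pushforward (sample_law nu1 nu2 n) hh]) => // A B mA mB.
rewrite /= /pushforward.
rewrite (_ : _ @^-1` _ = [set t | A (tnth t i)] `*` [set t | B (tnth t j)])//.
rewrite [LHS](product_measure1E (iid nu1 n) (iid nu2 n)).
- by congr (_ * _)%E; [exact: (iid1 _ _ nu1 i A mA)|exact: (iid1 _ _ nu2 j B mB)].
- exact: (mtn _ _ i A mA).
- exact: (mtn _ _ j B mB).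
Qed.

End edge_expectation.

Lemma measurable_superlevel (R : realType) d (T : measurableType d)
    (f : T -> R) (c : R) :
  measurable_fun setT f -> measurable [set x | c < f x].
Proof.
move=> mf; rewrite (_ : mkset _ = ~` (setT `&` [set x | f x <= c])).
  by apply/measurableC; exact: measurable_fun_le.
apply/seteqP; split=> x /=; rewrite ltNge; first by move=> /negP fc [_].
by move=> fc; apply/negP => ?; apply: fc.
Qed.

Section first_moment.
Context (R : realType) d1 d2 (T1 : measurableType d1) (T2 : measurableType d2).
Variables (nu1 : probability T1 R) (nu2 : probability T2 R) (U : T1 * T2 -> R).
Hypothesis hU : bigraphon U.
Variables (p : R) (hp0 : 0 <= p).
Hypothesis Up : prob (nu1 \x nu2)%E [set z | p < U z] = 0.

(** Union bound over the [n ^ (2 l)] pairs of maps: almost surely [U <= p] at each of the [l * l]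
    edges, so each pair contributes at most [p ^ (l * l)]. *)
Lemma bigraphon_pr_biclique_ge n l :
  bigraphon_pr nu1 nu2 U
    (fun E : {set 'I_n * 'I_n} => (l <= biclique_number E)%N) <=
  (n%:R ^+ 2 * p ^+ l) ^+ l.
Proof.
pose X := {ffun 'I_l -> 'I_n}.
pose V (fg : X * X) (xy : n.-tuple T1 * n.-tuple T2) :=
  \prod_(ij : 'I_l * 'I_l) U (tnth xy.1 (fg.1 ij.1), tnth xy.2 (fg.2 ij.2)).
have bV fg : bounded_measurable (V fg).
  by apply: bounded_measurable_prod => ij; exact: bounded_measurable_edge.
have V0 fg xy : 0 <= V fg xy.
  apply: prodr_ge0 => ij _.
  by have /andP[] := hU.2 (tnth xy.1 (fg.1 ij.1), tnth xy.2 (fg.2 ij.2)).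
pose inj2 (fg : X * X) := injectiveb fg.1 && injectiveb fg.2.
pose F (fg : X * X) : {set 'I_n * 'I_n} :=
  imset (fun ij : 'I_l * 'I_l => (fg.1 ij.1, fg.2 ij.2)) (mem predT).
(* Injectivity makes the [l * l] edges distinct; otherwise [V] would repeat factors. *)
have VF fg xy : inj2 fg ->
    \sum_(E : {set 'I_n * 'I_n} | F fg \subset E) edge_set_weight U E xy.1 xy.2 = V fg xy.
  move=> /andP[/injectiveP fI /injectiveP gI].
  rewrite edge_set_weight_superset big_imset/=.
    by apply: eq_bigl.
  by move=> [i j] [i' j'] _ _ /= [/fI -> /gI ->].
have le_cond xy : bigraphon_cond_pr U
    (fun E : {set 'I_n * 'I_n} => (l <= biclique_number E)%N) xy <=
    \sum_fg V fg xy.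
  rewrite (le_trans (y := \sum_(fg | inj2 fg) V fg xy))//; last first.
    by rewrite [leRHS](bigID inj2)/= lerDl; apply: sumr_ge0.
  under eq_bigr => fg fgI do rewrite -VF//.
  rewrite (exchange_big_dep xpredT)//= /bigraphon_cond_pr big_mkcond.
  apply: ler_sum => E _; case: ifPn => [lE|_]; last first.
    by apply: sumr_ge0 => fg _; exact: edge_set_weight_ge0.
  have [f [g [fI gI fgE]]] := biclique_number_inj lE.
  rewrite (bigD1 (f, g))/=.
    by rewrite lerDl; apply: sumr_ge0 => fg _; exact: edge_set_weight_ge0.
  rewrite /inj2/=; apply/andP; split.
    by apply/andP; split; exact/injectiveP.
  by apply/fintype.subsetP => _ /imsetP[[i j] _ ->].
have mD : measurable [set z | p < U z].
  by apply: measurable_superlevel; exact: hU.1.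
pose N (i j : 'I_n) : set (n.-tuple T1 * n.-tuple T2) :=
  [set xy | p < U (tnth xy.1 i, tnth xy.2 j)].
have mN i j : measurable (N i j).
  apply: measurable_superlevel; exact: (bounded_measurable_edge hU i j).1.
have N0 i j : prob (sample_law nu1 nu2 n) (N i j) = 0.
  by rewrite -Up; exact: (sample_edge_law nu1 nu2 i j mD).
have bN (fg : X * X) (ij : 'I_l * 'I_l) :=
  bounded_measurable_indic R (mN (fg.1 ij.1) (fg.2 ij.2)).
have EV fg : \int[sample_law nu1 nu2 n]_xy V fg xy <= p ^+ (l * l).
  have bS : bounded_measurable (fun xy : n.-tuple T1 * n.-tuple T2 =>
      \sum_(ij : 'I_l * 'I_l) (\1_(N (fg.1 ij.1) (fg.2 ij.2)) xy : R)).
    exact: bounded_measurable_sum.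
  have bp := @bounded_measurable_cst R _ (n.-tuple T1 * n.-tuple T2)%type (p ^+ (l * l)).
  (* An almost sure bound made pointwise: where some edge has [U > p], an indicator equal to [1]
     already dominates [V], and these indicators have expectation [0]. *)
  apply: (@le_trans _ _ (\int[sample_law nu1 nu2 n]_xy
    (p ^+ (l * l) + \sum_(ij : 'I_l * 'I_l)
       (\1_(N (fg.1 ij.1) (fg.2 ij.2)) xy : R)))).
    apply: le_expectation => //; first exact: bounded_measurableD.
    move=> xy.
    have [/existsP[ij Uij]|/existsPn Uij] := boolP [exists ij : 'I_l * 'I_l,
        p < U (tnth xy.1 (fg.1 ij.1), tnth xy.2 (fg.2 ij.2))].
      rewrite (le_trans (y := 1))//.
        by apply: prodr_ile1 => k _; exact: hU.2.
      rewrite ler_wpDl ?exprn_ge0// (bigD1 ij)//= indicE mem_set// lerDl.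
      by apply: sumr_ge0 => k _; rewrite indicE.
    rewrite ler_wpDr//; first by apply: sumr_ge0 => k _; rewrite indicE.
    rewrite -[X in p ^+ X](_ : #|{: 'I_l * 'I_l}| = _); last first.
      by rewrite card_prod card_ord.
    rewrite -prodr_const; apply: ler_prod => ij _.
    have /andP[-> _] := hU.2 (tnth xy.1 (fg.1 ij.1), tnth xy.2 (fg.2 ij.2)).
    by rewrite leNgt Uij.
  rewrite expectationD// expectation_cst expectation_sum//.
  by rewrite big1 ?addr0// => ij _; rewrite expectation_indic.
rewrite bigraphon_prE//.
apply: (@le_trans _ _ (\int[sample_law nu1 nu2 n]_xy (\sum_fg V fg xy))).
  apply: le_expectation => //; first exact: bounded_measurable_cond_pr.
  exact: bounded_measurable_sum.
rewrite expectation_sum//.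
apply: (@le_trans _ _ (\sum_(fg : X * X) p ^+ (l * l))); first exact: ler_sum.
rewrite sumr_const card_prod card_ffun !card_ord -[leLHS]mulr_natl.
by rewrite natrM natrX exprMn -expr2 -!exprM mulnC.
Qed.

End first_moment.

(** * Second moment *)

(* Chebyshev's inequality for [Z E = sum_k (g k / prod_(i in F k) u i) [F k <= E]],
   whose mean is [sum_k g k] and which vanishes on [Q]. *)
Lemma second_moment_weight (R : realFieldType) (I K : finType) (u : I -> R)
    (F : K -> {set I}) (g : K -> R) (r : R) (Q : pred {set I}) :
  (forall i, 0 <= u i <= 1) -> 0 < r -> (forall k, 0 <= g k) ->
  (forall k, g k != 0 -> forall i, i \in F k -> r <= u i) ->
  (forall E k, Q E -> ~~ (F k \subset E)) ->
  \sum_(E : {set I} | Q E) \prod_i (if i \in E then u i else 1 - u i) <=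
  \sum_k \sum_k' g k * g k' * r ^- #|F k :&: F k'| - 2 * \sum_k g k + 1.
Proof.
move=> u01 r0 g0 ru QF.
pose w (E : {set I}) := \prod_i (if i \in E then u i else 1 - u i).
have w0 E : 0 <= w E.
  by apply: prodr_ge0 => i _; have := u01 i; case: ifP => _; lra.
have wF (A : {set I}) : \sum_E w E * (A \subset E)%:R = \prod_(i in A) u i.
  rewrite -sum_edge_weight_superset [RHS]big_mkcond; apply: eq_bigr => E _.
  by case: ifP => _; rewrite ?mulr1 ?mulr0.
pose v k := \prod_(i in F k) u i.
have v0 k : g k != 0 -> 0 < v k.
  by move=> /ru rk; apply: prodr_gt0 => i /rk; exact: lt_le_trans.
(* If [v k = 0] then [g k = 0] by [v0], so the division does no harm. *)
pose Z (E : {set I}) := \sum_k g k / v k * (F k \subset E)%:R.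
have ZQ E : Q E -> Z E = 0.
  by move=> QE; apply: big1 => k _; rewrite (negbTE (QF _ _ QE)) mulr0.
have EZ : \sum_E w E * Z E = \sum_k g k.
  under eq_bigr do rewrite mulr_sumr.
  rewrite exchange_big/=; apply: eq_bigr => k _.
  under eq_bigr do rewrite mulrCA.
  rewrite -mulr_sumr wF -/(v k).
  have [->|gk] := eqVneq (g k) 0; first by rewrite !mul0r.
  by rewrite divfK// gt_eqF// v0.
have EZZ : \sum_E w E * (Z E * Z E) <=
    \sum_k \sum_k' g k * g k' * r ^- #|F k :&: F k'|.
  rewrite (_ : \sum_E w E * (Z E * Z E) = \sum_k \sum_k'
      g k / v k * (g k' / v k') * \prod_(i in F k :|: F k') u i); last first.
    under [LHS]eq_bigr => E _ do rewrite {1}/Z mulr_suml mulr_sumr.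
    rewrite exchange_big/=; apply: eq_bigr => k _.
    under [LHS]eq_bigr => E _ do rewrite /Z 2!mulr_sumr.
    rewrite exchange_big/=; apply: eq_bigr => k' _.
    rewrite -wF mulr_sumr; apply: eq_bigr => E _.
    rewrite finset.subUset.
    by case: (F k \subset E); case: (F k' \subset E) => /=; ring.
  apply: ler_sum => k _; apply: ler_sum => k' _.
  have [->|gk] := eqVneq (g k) 0; first by rewrite !mul0r.
  have [->|gk'] := eqVneq (g k') 0; first by rewrite !(mulr0, mul0r).
  have vk := v0 _ gk; have vk' := v0 _ gk'.
  have vI : r ^+ #|F k :&: F k'| <= \prod_(i in F k :&: F k') u i.
    rewrite -prodr_const; apply: ler_prod => i; rewrite inE => /andP[ik _].
    by rewrite (ltW r0) (ru _ gk).
  (* An index common to [F k] and [F k'] occurs once in the union and once in the intersection,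
     matching its two occurrences on the left. *)
  have vIU : v k * v k' =
      \prod_(i in F k :|: F k') u i * \prod_(i in F k :&: F k') u i.
    have mkcond (A : {set I}) : \prod_(i in A) u i = \prod_i (if i \in A then u i else 1).
      exact: big_mkcond.
    rewrite /v !mkcond -!big_split/=.
    apply: eq_bigr => i _; rewrite !inE.
    by case: (i \in F k); case: (i \in F k'); rewrite /= ?mul1r ?mulr1.
  have I0 : 0 < \prod_(i in F k :&: F k') u i.
    by rewrite (lt_le_trans _ vI)// exprn_gt0.
  rewrite (_ : _ * _ * _ = g k * g k' * (\prod_(i in F k :&: F k') u i)^-1).
    by rewrite ler_wpM2l ?mulr_ge0// lef_pV2// posrE// exprn_gt0.
  apply: (mulIf (lt0r_neq0 I0)); rewrite -[LHS]mulrA -vIU -[RHS]mulrA.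
  rewrite mulVf ?lt0r_neq0// mulr1.
  by field; rewrite !lt0r_neq0.
(* On [Q] the count [Z] vanishes and [(Z - 1) ^+ 2 = 1], so the square dominates the indicator of
   [Q]; its expansion uses that the total weight is [1]. *)
suff : \sum_(E : {set I} | Q E) w E <= \sum_E w E * (Z E - 1) ^+ 2.
  move=> /le_trans; apply.
  rewrite (_ : \sum_E w E * (Z E - 1) ^+ 2 =
      \sum_E w E * (Z E * Z E) - 2 * \sum_E w E * Z E + 1).
    by rewrite EZ lerD2r lerB.
  transitivity (\sum_E w E * (Z E * Z E) - 2 * \sum_E w E * Z E +
     \sum_E w E * (finset.set0 \subset E)%:R).
    rewrite mulr_sumr -sumrB -big_split/=; apply: eq_bigr => E _.
    by rewrite finset.sub0set mulr1; ring.
  by rewrite wF big_set0.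
rewrite [leLHS]big_mkcond; apply: ler_sum => E _; case: ifPn => [/ZQ ->|_].
  by rewrite sub0r sqrrN expr1n mulr1.
by rewrite mulr_ge0// sqr_ge0.
Qed.

(** * Selections of one index per block, and their overlaps *)

Section blocks.
Variables (n l m : nat) (lmn : (l * m <= n)%N).
Implicit Types X Y : {ffun 'I_l -> 'I_m}.

Lemma block_index_subproof X (i : 'I_l) : (i * m + X i < n)%N.
Proof.
apply: leq_trans lmn; apply: (@leq_trans (i.+1 * m)).
  by rewrite mulSn addnC ltn_add2r.
by rewrite leq_mul2r ltn_ord orbT.
Qed.

(* [X] selects one index from each of [l] disjoint blocks of [m] indices. *)
Definition block_index X (i : 'I_l) : 'I_n := Ordinal (block_index_subproof X i).

(** Division by [m] recovers the block, so two selections can only meet at equal positions. *)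
Lemma block_index_eq X X' i j :
  block_index X i = block_index X' j -> i = j /\ X i = X' i.
Proof.
move=> /(congr1 val)/= e; have m0 : (0 < m)%N by case: (X i) => k; case: m.
have ij : i = j.
  apply/val_inj; have := congr1 (fun k => k %/ m)%N e.
  by rewrite !divnMDl// !divn_small// !addn0.
split=> //; apply/val_inj; rewrite -ij in e.
by move/eqP: e; rewrite eqn_add2l => /eqP.
Qed.

Lemma block_index_inj X : injective (block_index X).
Proof. by move=> i j /block_index_eq[]. Qed.

Definition agreement X X' : {set 'I_l} := [set i | X i == X' i]%SET.

Definition block_biclique X Y : {set 'I_n * 'I_n} :=
  imset (fun ij : 'I_l * 'I_l => (block_index X ij.1, block_index Y ij.2))
    (mem predT).

(** Shared vertices on each side are exactly the positions of agreement, so the shared edges form a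
    product set. *)
Lemma card_block_bicliqueI X Y X' Y' :
  #|block_biclique X Y :&: block_biclique X' Y'| =
  (#|agreement X X'| * #|agreement Y Y'|)%N.
Proof.
rewrite -cardsX -(card_imset (mem (finset.setX (agreement X X') (agreement Y Y')))
  (f := fun ij : 'I_l * 'I_l => (block_index X ij.1, block_index Y ij.2))); last first.
  move=> [i j] [i' j'] e; congr pair.
    exact: block_index_inj (congr1 fst e).
  exact: block_index_inj (congr1 snd e).
apply: eq_card => ij; rewrite inE; apply/andP/imsetP => [[]|[[i j]]].
  move=> /imsetP[[i j] _ ->] /imsetP[[i' j'] _ e].
  have [_ ii'] := block_index_eq (congr1 fst e).
  have [_ jj'] := block_index_eq (congr1 snd e).
  by exists (i, j) => //; rewrite !inE/= ii' jj' !eqxx.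
rewrite !inE/= => /andP[/eqP Xi /eqP Yj] ->; split; apply/imsetP; exists (i, j) => //=.
by congr pair; apply/val_inj; rewrite /= ?Xi ?Yj.
Qed.

(** For fixed [X] the sum over [X'] factorises over positions: the agreeing value contributes [t]
    and the other [m - 1] values [1] each, at most [m + t] in total. *)
Lemma sum_agreement (R : numFieldType) (t : R) : 0 <= t ->
  \sum_X \sum_X' t ^+ #|agreement X X'| <= (m%:R * (m%:R + t)) ^+ l.
Proof.
move=> t0; rewrite exprMn -natrX.
have -> : (m ^ l)%N = #|{: {ffun 'I_l -> 'I_m}}| by rewrite card_ffun !card_ord.
rewrite mulr_natl -sumr_const; apply: ler_sum => X _.
have -> : \sum_X' t ^+ #|agreement X X'| =
    \sum_(X' : {ffun 'I_l -> 'I_m}) \prod_i (if X i == X' i then t else 1).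
  apply: eq_bigr => X' _; rewrite -prodr_const big_mkcond/=.
  by apply: eq_bigr => i _; rewrite inE.
rewrite -(bigA_distr_bigA (fun i k => if X i == k then t else 1))/=.
rewrite -[X in _ ^+ X]card_ord -prodr_const; apply: ler_prod => i _.
apply/andP; split; first by apply: sumr_ge0 => k _; case: ifP.
rewrite (bigD1 (X i))//= eqxx addrC lerD2r.
apply: (@le_trans _ _ (\sum_(k < m) (1 : R))); last first.
  by rewrite sumr_const card_ord.
rewrite [leRHS](bigD1 (X i))//= ler_wpDl//.
by apply: ler_sum => k /negbTE; rewrite eq_sym => ->.
Qed.

End blocks.

(** Since [a, b <= l], one has [2 a b <= l (a + b)]. This splits the correlation gain into one
    factor per shared left vertex and one per shared right vertex. *)
Lemma exp_overlap_le (R : realFieldType) (q : R) (l a b : nat) :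
  0 < q <= 1 -> (a <= l)%N -> (b <= l)%N ->
  (q ^+ 2) ^- (a * b) <= (q ^- l) ^+ a * (q ^- l) ^+ b.
Proof.
move=> /andP[q0 q1] al bl.
rewrite -!exprVn -!exprM -exprD; apply: ler_weXn2l; first by rewrite invf_ge1.
rewrite mul2n -addnn leq_add//.
  by rewrite mulnC leq_mul2r bl orbT.
by rewrite leq_mul2r al orbT.
Qed.

Lemma prob_iid_all (R : realType) d (T : measurableType d)
    (P : probability T R) n (A : set T) : measurable A ->
  prob (iid P n) [set t | forall i, A (tnth t i)] = prob P A ^+ n.
Proof.
move=> mA; apply: EFin_inj; rewrite -[X in _ ^+ X]card_ord -prodr_const -prodEFin.
rewrite -probE; last exact: (@measurable_box _ _ _ _ (@id 'I_n) (fun=> A)).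
transitivity (\prod_(i < n) P A)%E; first exact: (@iidE _ _ _ P n (fun=> A)).
by apply: eq_bigr => i _; exact: probE.
Qed.

(** * Tuples with a large common neighbourhood *)

Section good_tuples.
Context (R : realType) d1 d2 (T1 : measurableType d1) (T2 : measurableType d2).
Variables (nu1 : probability T1 R) (nu2 : probability T2 R).
Variables (S : set (T1 * T2)) (A : set T1) (B : set T2) (dl : R).
Hypotheses (mS : measurable S) (mA : measurable A) (mB : measurable B).
Hypotheses (A0 : 0 < prob nu1 A) (B0 : 0 < prob nu2 B) (dl01 : 0 < dl < 1).
Hypothesis dense : forall y, B y ->
  (1 - dl) * prob nu1 A <= prob nu1 (A `&` ysection S y).

(** The conditions on [A] do not involve [y]: they empty the neighbourhood as soon as an entry
    leaves [A], so that good tuples lie in [A]. *)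
Definition common_nbhd l (x : l.-tuple T1) : set T2 :=
  [set y | B y /\ forall i, A (tnth x i) /\ S (tnth x i, y)].

Let incidence l : set (l.-tuple T1 * T2) :=
  [set z | B z.2 /\ forall i, A (tnth z.1 i) /\ S (tnth z.1 i, z.2)].

Let measurable_incidence l : measurable (@incidence l).
Proof.
rewrite (_ : @incidence l = (setT `*` B) `&` \bigcap_(i in [set: 'I_l])
    ((fun z : l.-tuple T1 * T2 => (tnth z.1 i, z.2)) @^-1` ((A `*` setT) `&` S))).
  apply: measurableI; first exact: measurableX.
  apply: fin_bigcap_measurable => // i _.
  rewrite -[X in measurable X]setTI.
  have mh : measurable_fun setT (fun z : l.-tuple T1 * T2 => (tnth z.1 i, z.2)).
    apply: measurable_fun_pair => //.
    exact: (measurableT_comp (measurable_tnth i) measurable_fst).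
  by apply: mh => //; apply: measurableI => //; exact: measurableX.
apply/seteqP; split=> z /= [].
  by move=> Bz ASz; split=> // i _; have [] := ASz i.
by move=> [_ Bz] ASz; split=> // i; have [[]] := ASz i I.
Qed.

Let xsection_incidence l x : xsection (@incidence l) x = common_nbhd x.
Proof.
by apply/seteqP; split=> y; [move=> /set_mem|move=> ?; exact: mem_set].
Qed.

Lemma measurable_common_nbhd l (x : l.-tuple T1) : measurable (common_nbhd x).
Proof.
rewrite -xsection_incidence; 
  by apply: measurable_xsection; exact: measurable_incidence. Qed.

(* Half of the guaranteed density of a common neighbourhood, relative to [B]. *)
Definition nbhd_ratio l : R := (1 - dl) ^+ l / 2.

Definition good_tuple l : set (l.-tuple T1) :=
  [set x | prob nu2 B * nbhd_ratio l <= prob nu2 (common_nbhd x)].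

Lemma nbhd_ratio_gt0 l : 0 < nbhd_ratio l.
Proof. by have /andP[? ?] := dl01; rewrite divr_gt0// exprn_gt0// subr_gt0. Qed.

Lemma nbhd_ratio_le1 l : nbhd_ratio l <= 1.
Proof.
have /andP[? ?] := dl01; have : (1 - dl) ^+ l <= 1 by apply: exprn_ile1; lra.
by rewrite /nbhd_ratio; lra.
Qed.

Lemma measurable_good_tuple l : measurable (@good_tuple l).
Proof.
rewrite -[X in measurable X]setTI; apply: measurable_fun_le => //.
have [+ _] := bounded_measurable_xsection (iid nu1 l) nu2 (@measurable_incidence l).
by under eq_fun do rewrite xsection_incidence.
Qed.

Lemma good_tuple_sub l (x : l.-tuple T1) i : good_tuple x -> A (tnth x i).
Proof.
move=> gx; have : 0 < prob nu2 (common_nbhd x).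
  by apply: lt_le_trans gx; rewrite mulr_gt0// nbhd_ratio_gt0.
have [->|/set0P[y [_ /(_ i)[]]]//] := eqVneq (common_nbhd x) set0.
by rewrite prob0 ltxx.
Qed.

(* The mean of [nu2 (common_nbhd x)] is at least twice the threshold defining a
   good tuple, times the probability that all entries lie in [A]. *)
Lemma prob_good_tuple l :
  prob nu1 A ^+ l * nbhd_ratio l <= prob (iid nu1 l) (@good_tuple l).
Proof.
have mI := @measurable_incidence l.
have mAl : measurable [set x : l.-tuple T1 | forall i, A (tnth x i)].
  exact: (@measurable_box _ _ _ _ (@id 'I_l) (fun=> A)).
have pAl : prob (iid nu1 l) [set x | forall i, A (tnth x i)] = prob nu1 A ^+ l.
  exact: prob_iid_all.
(* Integrate over [y] first: for [y] in [B] the [l] independent entries all fall in [A] and in the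
   section of [S] with probability at least [((1 - dl) * nu1 A) ^ l]. *)
have lower : prob nu2 B * ((1 - dl) * prob nu1 A) ^+ l <=
    prob (iid nu1 l \x nu2)%E (@incidence l).
  rewrite prob_ysection// mulrC -(expectation_indic nu2 mB).
  have bB := bounded_measurable_indic R mB.
  rewrite -expectationZ//; apply: le_expectation => [||y].
  - by apply: bounded_measurableM => //; exact: bounded_measurable_cst.
  - exact: (bounded_measurable_ysection (iid nu1 l) nu2).
  have [yB|yB] := pselect (B y); last by rewrite indicE memNset// mulr0 prob_ge0.
  rewrite indicE mem_set// mulr1.
  rewrite (_ : ysection _ _ =
      [set x | forall i : 'I_l, (A `&` ysection S y) (tnth x i)]); last first.
    apply/seteqP; split=> x.
      by move=> /set_mem[_ ASx] i; have [? ?] := ASx i; split=> //; exact: mem_set.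
    move=> ASx; apply: mem_set; split=> // i.
    by have [? /set_mem] := ASx i.
  have mASy : measurable (A `&` ysection S y).
    by apply: measurableI => //; exact: measurable_ysection.
  rewrite prob_iid_all//; apply: lerXn2r; last exact: dense.
    by rewrite nnegrE mulr_ge0 ?prob_ge0// subr_ge0; have /andP[_ /ltW] := dl01.
  by rewrite nnegrE prob_ge0.
(* Integrate over [x] first: a good tuple contributes at most [nu2 B], any other tuple in [A] less
   than the threshold, and a tuple leaving [A] nothing. *)
have upper : prob (iid nu1 l \x nu2)%E (@incidence l) <=
    prob nu2 B * prob (iid nu1 l) (@good_tuple l) +
    prob nu2 B * nbhd_ratio l * prob nu1 A ^+ l.
  have mG := @measurable_good_tuple l.
  have bG := bounded_measurable_indic R mG.
  have bA := bounded_measurable_indic R mAl.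
  have bc c := bounded_measurable_cst (l.-tuple T1) (c : R).
  rewrite prob_xsection// -pAl -(expectation_indic _ mG) -(expectation_indic _ mAl).
  rewrite -!expectationZ// -expectationD; last 2 first.
  - exact: bounded_measurableM.
  - exact: bounded_measurableM.
  apply: le_expectation => [||x].
  - exact: (bounded_measurable_xsection (iid nu1 l) nu2).
  - by apply: bounded_measurableD; apply: bounded_measurableM.
  rewrite xsection_incidence.
  have t0 : 0 <= prob nu2 B * nbhd_ratio l.
    by rewrite mulr_ge0 ?prob_ge0// ltW// nbhd_ratio_gt0.
  have [gx|gx] := pselect (good_tuple x).
    rewrite [\1_(@good_tuple l) x]indicE mem_set// mulr1 ler_wpDr//.
      by rewrite mulr_ge0// indicE.
    by apply: le_prob => //; [exact: measurable_common_nbhd|move=> y []].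
  rewrite [\1_(@good_tuple l) x]indicE memNset// mulr0 add0r.
  have [Ax|Ax] := pselect (forall i, A (tnth x i)).
    by rewrite indicE mem_set// mulr1 leNgt; apply/negP => /ltW.
  rewrite (_ : common_nbhd x = set0) ?prob0.
    by rewrite mulr_ge0// indicE.
  by apply/seteqP; split=> y // [_ ASx]; apply: Ax => i; have [] := ASx i.
have := le_trans lower upper.
rewrite -mulrA -mulrDr ler_pM2l// exprMn.
(* The lower bound is twice the contribution allowed to tuples that are not good, so half of it must
   come from good ones. *)
have -> : (1 - dl) ^+ l = 2 * nbhd_ratio l by rewrite /nbhd_ratio; lra.
by rewrite -mulrA [nbhd_ratio l * _]mulrC; lra.
Qed.

End good_tuples.

(** * Independence for block selections *)

Section block_probabilities.
Context (R : realType) d (T : measurableType d) (P : probability T R).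
Variables (n l m : nat) (lmn : (l * m <= n)%N).
Implicit Types X : {ffun 'I_l -> 'I_m}.

Lemma measurable_block_all X (N : set T) : measurable N ->
  measurable [set t : n.-tuple T | forall j, N (tnth t (block_index lmn X j))].
Proof. by move=> mN; exact: (@measurable_box _ _ _ _ _ (fun=> N)). Qed.

Lemma measurable_block_select X (C : set (l.-tuple T)) : measurable C ->
  measurable [set t : n.-tuple T | C (tuple_select (block_index lmn X) t)].
Proof.
by move=> mC; rewrite -[X in measurable X]setTI; exact: measurable_tuple_select.
Qed.

Lemma prob_block_select X (C : set (l.-tuple T)) : measurable C ->
  prob (iid P n) [set t | C (tuple_select (block_index lmn X) t)] =
  prob (iid P l) C.
Proof.
move=> mC; congr fine; apply: iid_select => //; exact: block_index_inj.
Qed.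

Lemma prob_block_all X (N : set T) : measurable N ->
  prob (iid P n) [set t | forall j, N (tnth t (block_index lmn X j))] =
  prob P N ^+ l.
Proof.
move=> mN; rewrite -prob_iid_all// -(prob_block_select X); last first.
  exact: (@measurable_box _ _ _ _ (@id 'I_l) (fun=> N)).
congr (prob _ _); apply/seteqP; split=> t /= Nt j.
  by rewrite tnth_mktuple.
by have := Nt j; rewrite tnth_mktuple.
Qed.

Lemma prob_block_select_all X X' (C : set (l.-tuple T)) (N : set T) :
  measurable C -> measurable N ->
  prob (iid P n) [set t | C (tuple_select (block_index lmn X) t) /\
                          forall j, N (tnth t (block_index lmn X' j))] <=
  prob (iid P l) C * prob P N ^+ (l - #|agreement X X'|).
Proof.
move=> mC mN; pose J := {j : 'I_l | X j != X' j}.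
have cJ : (l - #|agreement X X'|)%N = #|{: J}|.
  rewrite card_sig -[X in (X - _)%N]card_ord -(cardsC (agreement X X')) addKn.
  by apply: eq_card => j; rewrite !inE.
have mE : measurable [set t : n.-tuple T | C (tuple_select (block_index lmn X) t) /\
    forall j : J, N (tnth t (block_index lmn X' (val j)))].
  apply: measurableI; first exact: measurable_block_select.
  exact: (@measurable_box _ _ _ _ _ (fun=> N)).
have mE' : measurable [set t : n.-tuple T | C (tuple_select (block_index lmn X) t) /\
    forall j, N (tnth t (block_index lmn X' j))].
  apply: measurableI; first exact: measurable_block_select.
  exact: measurable_block_all.
apply: (le_trans (le_prob _ mE' mE _)).
  by move=> t /= [Ct Nt]; split=> // j; exact: Nt.
rewrite le_eqVlt; apply/orP; left; apply/eqP; apply: EFin_inj.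
rewrite -probE// cJ mulrC EFinM -probE// -prodr_const -prodEFin.
rewrite (eq_bigr (fun=> P N)) => [|j _]; last by rewrite -probE.
apply: (@iid_select_box _ _ _ P n l (block_index lmn X) J
  (fun j => block_index lmn X' (val j)) C (fun=> N)) => //.
- exact: block_index_inj.
- by move=> i j /block_index_inj /val_inj.
- move=> i j; apply/eqP => e; have [ij] := block_index_eq e.
  by rewrite ij => Xj; have := valP j; rewrite Xj eqxx.
Qed.

Lemma prob_block_select2 X X' (C C' : set (l.-tuple T)) :
  #|agreement X X'| = 0%N -> measurable C -> measurable C' ->
  prob (iid P n) [set t | C (tuple_select (block_index lmn X) t) /\
                          C' (tuple_select (block_index lmn X') t)] =
  prob (iid P l) C * prob (iid P l) C'.
Proof.
move=> XX' mC mC'; apply: EFin_inj; rewrite EFinM -!probE//; last first.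
  by apply: measurableI; exact: measurable_block_select.
apply: iid_select2 => //; [exact: block_index_inj..|].
move=> i j; apply/eqP => e; have [_ Xi] := block_index_eq e.
by have := card0_eq XX' i; rewrite inE Xi eqxx.
Qed.

End block_probabilities.

(** * Variance of the weighted biclique count *)

Section second_moment.
Context (R : realType) d1 d2 (T1 : measurableType d1) (T2 : measurableType d2).
Variables (nu1 : probability T1 R) (nu2 : probability T2 R) (U : T1 * T2 -> R).
Hypothesis hU : bigraphon U.
Variables (q : R) (A : set T1) (B : set T2) (dl : R).
Let S := [set z | q ^+ 2 <= U z].
Hypotheses (mA : measurable A) (mB : measurable B).
Hypotheses (A0 : 0 < prob nu1 A) (B0 : 0 < prob nu2 B) (dl01 : 0 < dl < 1).
Hypothesis q01 : 0 < q <= 1.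
Hypothesis dense : forall y, B y ->
  (1 - dl) * prob nu1 A <= prob nu1 (A `&` ysection S y).
Variables (n l m : nat) (lmn : (l * m <= n)%N).
Hypothesis m0 : (0 < m)%N.

Let X := {ffun 'I_l -> 'I_m}.
Let a := prob nu1 A.
Let b := prob nu2 B.
Let kp := nbhd_ratio dl l.
Let G : set (l.-tuple T1) := @good_tuple _ _ _ T1 T2 nu2 S A B dl l.
Let gm := prob (iid nu1 l) G.

Let mS : measurable S.
Proof.
rewrite -[S]setTI; apply: measurable_fun_le => //; exact: hU.1.
Qed.

Let mG : measurable G.
Proof. exact: measurable_good_tuple. Qed.

Let kp0 : 0 < kp. Proof. exact: nbhd_ratio_gt0. Qed.
Let kp1 : kp <= 1. Proof. exact: nbhd_ratio_le1. Qed.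
Let gm_ge : a ^+ l * kp <= gm. Proof. exact: prob_good_tuple. Qed.
Let gm0 : 0 < gm.
Proof. by apply: lt_le_trans gm_ge; rewrite mulr_gt0// exprn_gt0. Qed.

Let sel (f : X) (x : n.-tuple T1) : l.-tuple T1 :=
  tuple_select (block_index lmn f) x.
Let N (f : X) (x : n.-tuple T1) : set T2 := common_nbhd S A B (sel f x).
Let D (x : n.-tuple T1) (k : X * X) : set (n.-tuple T2) :=
  [set y | forall j, N k.1 x (tnth y (block_index lmn k.2 j))].
Let Gs (f : X) : set (n.-tuple T1) := [set x | G (sel f x)].

Let mN f x : measurable (N f x).
Proof. exact: measurable_common_nbhd. Qed.

Let mD x k : measurable (D x k).
Proof. exact: measurable_block_all. Qed.

Let mGs f : measurable (Gs f).
Proof. exact: (measurable_block_select lmn f mG). Qed.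

(** Let [r] be the number of agreements. For [r = 0] the events are independent. For [r > 0] the
    second event is relaxed to its entries lying in [A], at cost [a ^ (l - r)]; then
    [a ^ l * kp ^ r <= a ^ l * kp <= gm], where [r > 0] gives [kp ^ r <= kp]. *)
Let prob_Gs2 (f f' : X) :
  prob (iid nu1 n) (Gs f `&` Gs f') <= gm ^+ 2 * (a * kp)^-1 ^+ #|agreement f f'|.
Proof.
case: (posnP #|agreement f f'|) => [ff'|ff'].
  by rewrite ff' expr0 mulr1 expr2 -(prob_block_select2 _ lmn ff' mG mG).
have mAf := measurable_block_all lmn f' mA.
apply: le_trans (le_trans (prob_block_select_all nu1 lmn f f' mG mA) _).
  apply: le_prob.
  - exact: measurableI.
  - by apply: measurableI => //; exact: measurable_block_select.
  - move=> x [Gx Gx']; split=> // j.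
    have := good_tuple_sub B0 dl01 j Gx'.
    by rewrite tnth_mktuple.
rewrite -/gm -/a expr2 -mulrA ler_pM2l// exprVn.
have ak0 : 0 < (a * kp) ^+ #|agreement f f'| by rewrite exprn_gt0// mulr_gt0.
rewrite ler_pdivlMr// exprMn mulrA -exprD subnK; last first.
  by rewrite -[X in (_ <= X)%N]card_ord max_card.
apply: le_trans gm_ge; rewrite ler_pM2l ?exprn_gt0//.
by rewrite -[leRHS]expr1 ler_wiXn2l// ltW.
Qed.

(* Weights [g x k y] of the pairs [k] of index selections: [k.1] conditioned on
   selecting a good tuple, then [k.2] conditioned on lying in its common
   neighbourhood, normalised so that the total expectation is [1]. *)
Let c : R := ((m ^ l)%:R ^+ 2 * gm)^-1.
Let g x (k : X * X) y : R :=
  c * \1_(Gs k.1) x * (prob nu2 (N k.1 x) ^- l) * \1_(D x k) y.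

Let c0 : 0 < c.
Proof. by rewrite invr_gt0 mulr_gt0// exprn_gt0// ltr0n expn_gt0 m0. Qed.

Let g0 x k y : 0 <= g x k y.
Proof.
rewrite /g !indicE; apply: mulr_ge0 => //; apply: mulr_ge0.
  by rewrite mulr_ge0 ?(ltW c0).
by rewrite invr_ge0 exprn_ge0 ?prob_ge0.
Qed.

Let bg x k : bounded_measurable (g x k).
Proof.
apply: bounded_measurableM; first exact: bounded_measurable_cst.
exact: bounded_measurable_indic.
Qed.

Let nbhd_ge x f : Gs f x -> b * kp <= prob nu2 (N f x).
Proof. by []. Qed.

Let nbhd_gt0 x f : Gs f x -> 0 < prob nu2 (N f x).
Proof. by move=> /nbhd_ge; apply: lt_le_trans; rewrite mulr_gt0. Qed.

Let Eg x k : \int[iid nu2 n]_y g x k y = c * \1_(Gs k.1) x.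
Proof.
have bD := bounded_measurable_indic R (mD x k).
rewrite expectationZ// expectation_indic// prob_block_all//.
have [Gx|Gx] := pselect (Gs k.1 x); last by rewrite indicE memNset// mulr0 !mul0r.
by rewrite -mulrA mulVf ?mulr1// expf_neq0// gt_eqF// nbhd_gt0.
Qed.

(** With [r] agreements on the right, the joint event has probability at most
    [v ^ l * v' ^ (l - r)]. The normalisation leaves [v' ^- r], and goodness gives
    [v' >= b * kp]. *)
Let Egg x k k' : \int[iid nu2 n]_y (g x k y * g x k' y) <=
  c ^+ 2 * \1_(Gs k.1 `&` Gs k'.1) x * (b * kp)^-1 ^+ #|agreement k.2 k'.2|.
Proof.
have [[Gx Gx']|GG] := pselect (Gs k.1 x /\ Gs k'.1 x); last first.
  rewrite indicE memNset// mulr0 mul0r.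
  rewrite (@eq_Rintegral _ _ _ _ setT (cst 0)) ?expectation_cst//.
  move=> y _; rewrite /g; case: (pselect (Gs k.1 x)) => Gx; last first.
    by rewrite [X in c * X * _]indicE memNset// mulr0 !mul0r.
  case: (pselect (Gs k'.1 x)) => Gx'; first by case: GG.
  by rewrite [\1_(Gs k'.1) x]indicE memNset// mulr0 !mul0r mulr0.
rewrite indicE mem_set// mulr1.
have v0 := nbhd_gt0 Gx; have v0' := nbhd_gt0 Gx'.
set v := prob nu2 (N k.1 x) in v0 *; set v' := prob nu2 (N k'.1 x) in v0' *.
have mDD : measurable (D x k `&` D x k') by exact: measurableI.
have bDD := bounded_measurable_indic R mDD.
rewrite (@eq_Rintegral _ _ _ _ setT
  (fun y => c ^+ 2 * (v ^- l * v' ^- l) * \1_(D x k `&` D x k') y)).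
  rewrite expectationZ// expectation_indic// -mulrA ler_pM2l ?exprn_gt0//.
  have le_ag := max_card (agreement k.2 k'.2); rewrite card_ord in le_ag.
  have DD : prob (iid nu2 n) (D x k `&` D x k') <=
      v ^+ l * v' ^+ (l - #|agreement k.2 k'.2|).
    have mC := @measurable_box _ _ l _ (@id 'I_l) (fun=> N k.1 x) (fun=> mN k.1 x).
    have := prob_block_select_all nu2 lmn k.2 k'.2 mC (mN k'.1 x).
    rewrite prob_iid_all//; apply: le_trans.
    rewrite le_eqVlt; apply/orP; left; apply/eqP; congr (prob _ _).
    apply/seteqP; split=> y [Dy Dy']; split=> //= j.
      by rewrite tnth_mktuple.
    by have := Dy j; rewrite /= tnth_mktuple.
  apply: (@le_trans _ _ (v ^- l * v' ^- l *
    (v ^+ l * v' ^+ (l - #|agreement k.2 k'.2|)))).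
    by rewrite ler_wpM2l// mulr_ge0// invr_ge0 exprn_ge0// ltW.
  rewrite mulrACA mulVf ?expf_neq0 ?gt_eqF// mul1r.
  rewrite -[X in v' ^- X](subnK le_ag) exprD invfM mulrAC mulVf ?expf_neq0 ?gt_eqF//.
  rewrite mul1r -exprVn lerXn2r ?nnegrE ?invr_ge0 ?(ltW v0')//.
    exact: ltW (mulr_gt0 B0 kp0).
  have bk0 : 0 < b * kp := mulr_gt0 B0 kp0.
  by rewrite lef_pV2 ?posrE//; exact: (nbhd_ge Gx').
move=> y _; rewrite /g -/v -/v' [\1_(Gs k.1) x]indicE [\1_(Gs k'.1) x]indicE.
by rewrite !mem_set// indicI !mulr1 /=; ring.
Qed.

Let s : R := q ^- l.
Let s0 : 0 < s.
Proof. by rewrite invr_gt0 exprn_gt0//; have /andP[] := q01. Qed.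

Let ov (k k' : X * X) : nat :=
  #|block_biclique lmn k.1 k.2 :&: block_biclique lmn k'.1 k'.2|.

(** Chebyshev's inequality conditionally on the samples: a positive weight forces all edges of the
    block biclique into [S], where [U >= q ^+ 2]. *)
Let cond_le x y : bigraphon_cond_pr U
    (fun E : {set 'I_n * 'I_n} => (biclique_number E < l)%N) (x, y) <=
  \sum_k \sum_k' g x k y * g x k' y * (q ^+ 2) ^- ov k k' -
  2 * \sum_k g x k y + 1.
Proof.
have q20 : 0 < q ^+ 2 by rewrite exprn_gt0//; have /andP[] := q01.
apply: (second_moment_weight (K := (X * X)%type)
  (u := fun ij => U (tnth x ij.1, tnth y ij.2))
  (F := fun k => block_biclique lmn k.1 k.2)) => // [ij|k gk ij|E k El].
- exact: hU.2.
- have Gx : Gs k.1 x.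
    apply: contrapT => Gx; move: gk.
    by rewrite /g indicE memNset// mulr0 !mul0r eqxx.
  have Dy : D x k y.
    apply: contrapT => Dy; move: gk.
    by rewrite /g [\1_(D x k) y]indicE memNset// mulr0 eqxx.
  move=> /imsetP[[i j] _ ->] /=.
  by have [_ /(_ i)[_]] := Dy j; rewrite tnth_mktuple.
- apply/negP => /fintype.subsetP FE; move: El; rewrite ltnNge => /negP; apply.
  apply: (biclique_number_ge_inj (f := block_index lmn k.1) (g := block_index lmn k.2)).
  + exact: block_index_inj.
  + exact: block_index_inj.
  + by move=> i j; apply: FE; apply/imsetP; exists (i, j).
Qed.

Let ov_le k k' : (q ^+ 2) ^- ov k k' <=
  s ^+ #|agreement k.1 k'.1| * s ^+ #|agreement k.2 k'.2|.
Proof.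
rewrite /ov card_block_bicliqueI; apply: exp_overlap_le => //.
  by rewrite -[X in (_ <= X)%N]card_ord max_card.
by rewrite -[X in (_ <= X)%N]card_ord max_card.
Qed.

(** Bound for a pair of weights after integrating out [y], apart from the indicator that both left
    selections are good: each shared vertex costs [s], and each shared right vertex also
    [(b * kp)^-1]. *)
Let W (k k' : X * X) : R :=
  c ^+ 2 * (s ^+ #|agreement k.1 k'.1| *
    (s * (b * kp)^-1) ^+ #|agreement k.2 k'.2|).

Let H x : R := \sum_k \sum_k' W k k' * \1_(Gs k.1 `&` Gs k'.1) x +
  (- 2 * (\sum_(k : X * X) c * \1_(Gs k.1) x) + 1).

Let bH1 : bounded_measurable
  (fun x => \sum_k \sum_k' W k k' * \1_(Gs k.1 `&` Gs k'.1) x).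
Proof.
apply: bounded_measurable_sum => k; apply: bounded_measurable_sum => k'.
apply: bounded_measurableM; first exact: bounded_measurable_cst.
by apply: bounded_measurable_indic; exact: measurableI.
Qed.

Let bH2 : bounded_measurable (fun x => \sum_(k : X * X) c * (\1_(Gs k.1) x : R)).
Proof.
apply: bounded_measurable_sum => k.
apply: bounded_measurableM; first exact: bounded_measurable_cst.
exact: bounded_measurable_indic.
Qed.

Let bH3 : bounded_measurable
  (fun x => - 2 * (\sum_(k : X * X) c * (\1_(Gs k.1) x : R)) + 1).
Proof.
apply: bounded_measurableD; last exact: bounded_measurable_cst.
by apply: bounded_measurableM => //; exact: bounded_measurable_cst.
Qed.

Let cond_expectation_le x : \int[iid nu2 n]_y bigraphon_cond_pr U
    (fun E : {set 'I_n * 'I_n} => (biclique_number E < l)%N) (x, y) <= H x.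
Proof.
have b1 k k' : bounded_measurable (fun y => (q ^+ 2) ^- ov k k' * (g x k y * g x k' y)).
  apply: bounded_measurableM; first exact: bounded_measurable_cst.
  exact: bounded_measurableM.
have b1s k : bounded_measurable (fun y =>
    \sum_k' (q ^+ 2) ^- ov k k' * (g x k y * g x k' y)).
  exact: bounded_measurable_sum.
have b1ss : bounded_measurable (fun y =>
    \sum_k \sum_k' (q ^+ 2) ^- ov k k' * (g x k y * g x k' y)).
  exact: bounded_measurable_sum.
have b2 : bounded_measurable (fun y => \sum_k g x k y).
  exact: bounded_measurable_sum.
have b21 : bounded_measurable (fun y => - 2 * \sum_k g x k y).
  by apply: bounded_measurableM => //; exact: bounded_measurable_cst.
have b3 : bounded_measurable (fun y => - 2 * (\sum_k g x k y) + 1).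
  by apply: bounded_measurableD => //; exact: bounded_measurable_cst.
apply: (@le_trans _ _ (\int[iid nu2 n]_y (
    (\sum_k \sum_k' (q ^+ 2) ^- ov k k' * (g x k y * g x k' y)) +
    (- 2 * (\sum_k g x k y) + 1)))).
  apply: le_expectation.
  - exact: (bounded_measurable_pair1 (bounded_measurable_cond_pr hU _)).
  - exact: bounded_measurableD.
  - move=> y; apply: le_trans (cond_le x y) _; rewrite mulNr addrA lerD2r lerD2r.
    by apply: ler_sum => k _; apply: ler_sum => k' _; rewrite mulrC.
rewrite expectationD// expectationD//; last exact: bounded_measurable_cst.
rewrite expectationZ// expectation_cst !expectation_sum// /H.
rewrite [X in _ + (_ * X + _) <= _](eq_bigr
  (fun k : X * X => c * \1_(Gs k.1) x)); last first.
  by move=> k _; exact: Eg.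
rewrite lerD2r; apply: ler_sum => k _; rewrite expectation_sum//.
apply: ler_sum => k' _.
rewrite expectationZ//; last exact: bounded_measurableM.
have ov0 : 0 <= (q ^+ 2) ^- ov k k'.
  by rewrite invr_ge0 !exprn_ge0//; have /andP[/ltW] := q01.
apply: le_trans (ler_wpM2l ov0 (Egg x k k')) _.
have i0 : 0 <= (\1_(Gs k.1 `&` Gs k'.1) x : R) by rewrite indicE.
have bk0 : 0 < b * kp := mulr_gt0 B0 kp0.
have r0 : 0 <= c ^+ 2 * \1_(Gs k.1 `&` Gs k'.1) x * (b * kp)^-1 ^+ #|agreement k.2 k'.2|.
  apply: mulr_ge0; first by apply: mulr_ge0 => //; exact: sqr_ge0.
  by rewrite exprn_ge0// invr_ge0 ltW.
apply: le_trans (ler_wpM2r r0 (ov_le k k')) _.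
rewrite /W exprMn le_eqVlt; apply/orP; left; apply/eqP; ring.
Qed.

(** Integrating out [x] as well, the double sum over pairs splits into a left and a right agreement
    sum, both bounded by [sum_agreement]; the normalisation [(c * gm) ^+ 2 = m ^ (- 4 l)] turns
    [m (m + t)] into [1 + t / m]. *)
Lemma bigraphon_pr_biclique_lt :
  bigraphon_pr nu1 nu2 U
    (fun E : {set 'I_n * 'I_n} => (biclique_number E < l)%N) <=
  ((1 + s * (a * kp)^-1 / m%:R) * (1 + s * (b * kp)^-1 / m%:R)) ^+ l - 1.
Proof.
have bc := bounded_measurable_cond_pr hU
  (fun E : {set 'I_n * 'I_n} => (biclique_number E < l)%N).
rewrite bigraphon_prE// expectation_prod1//.
apply: (@le_trans _ _ (\int[iid nu1 n]_x H x)).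
  apply: le_expectation => //; first exact: (bounded_measurable_expectation1 (iid nu1 n)).
  exact: bounded_measurableD.
have bG1 k := bounded_measurable_indic R (mGs k).
have bG2 k k' := bounded_measurable_indic R (measurableI _ _ (mGs k) (mGs k')).
have bc1 r := @bounded_measurable_cst R _ (n.-tuple T1) r.
have bWG k k' : bounded_measurable (fun x => W k k' * \1_(Gs k.1 `&` Gs k'.1) x).
  exact: bounded_measurableM.
have bcG (k : X * X) : bounded_measurable (fun x => c * (\1_(Gs k.1) x : R)).
  exact: bounded_measurableM.
rewrite expectationD// expectationD//; last exact: bounded_measurableM.
rewrite expectationZ// expectation_cst !expectation_sum//; last first.
  by move=> k; exact: bounded_measurable_sum.
have mm0 : 0 < (m ^ l)%:R :> R by rewrite ltr0n expn_gt0 m0.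
have cardX : #|{: X * X}|%:R = (m ^ l)%:R ^+ 2 :> R.
  by rewrite card_prod card_ffun !card_ord natrM.
(* The weights have total expectation [1], so the last two terms of [H] contribute [- 2 + 1]. *)
rewrite [X in _ + (_ * X + _)](_ : _ = 1); last first.
  rewrite (eq_bigr (fun=> c * gm)) => [|k _]; last first.
    rewrite expectationZ// expectation_indic//; congr (_ * _).
    exact: (prob_block_select nu1 lmn k.1 mG).
  rewrite sumr_const -mulr_natl cardX /c; field.
  by rewrite !gt_eqF.
suff : \sum_k \int[iid nu1 n]_x (\sum_k' W k k' * \1_(Gs k.1 `&` Gs k'.1) x) <=
    ((1 + s * (a * kp)^-1 / m%:R) * (1 + s * (b * kp)^-1 / m%:R)) ^+ l.
  by lra.
pose t1 := s * (a * kp)^-1; pose t2 := s * (b * kp)^-1.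
have t10 : 0 <= t1 by rewrite ltW// mulr_gt0// invr_gt0 mulr_gt0.
have t20 : 0 <= t2 by rewrite ltW// mulr_gt0// invr_gt0 mulr_gt0.
apply: (@le_trans _ _ (\sum_(k : X * X) \sum_(k' : X * X) (c * gm) ^+ 2 *
    (t1 ^+ #|agreement k.1 k'.1| * t2 ^+ #|agreement k.2 k'.2|))).
  apply: ler_sum => k _; rewrite expectation_sum//; apply: ler_sum => k' _.
  rewrite expectationZ// expectation_indic//; last exact: measurableI.
  have W0 : 0 <= W k k'.
    by rewrite /W !mulr_ge0 ?exprn_ge0 ?(ltW c0) ?(ltW s0).
  apply: le_trans (ler_wpM2l W0 (prob_Gs2 _ _)) _.
  rewrite /W -/t2 /t1 (exprMn _ c gm) (exprMn _ s (a * kp)^-1).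
  rewrite le_eqVlt; apply/orP; left; apply/eqP; ring.
have -> : \sum_(k : X * X) \sum_(k' : X * X) (c * gm) ^+ 2 *
      (t1 ^+ #|agreement k.1 k'.1| * t2 ^+ #|agreement k.2 k'.2|) =
    (c * gm) ^+ 2 *
    ((\sum_(f : X) \sum_(f' : X) t1 ^+ #|agreement f f'|) *
     (\sum_(f : X) \sum_(f' : X) t2 ^+ #|agreement f f'|)).
  have pairE (u v : X -> R) :
      \sum_(k : X * X) u k.1 * v k.2 = (\sum_f u f) * (\sum_f v f).
    by rewrite big_distrlr pair_bigA.
  under eq_bigr => k _ do rewrite -mulr_sumr (pairE
    (fun f => t1 ^+ #|agreement k.1 f|) (fun f => t2 ^+ #|agreement k.2 f|)).
  by rewrite -mulr_sumr (pairE (fun f => \sum_(f' : X) t1 ^+ #|agreement f f'|)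
    (fun f => \sum_(f' : X) t2 ^+ #|agreement f f'|)).
have sum0 t : 0 <= t -> 0 <= \sum_(f : X) \sum_(f' : X) t ^+ #|agreement f f'| :> R.
  by move=> t0; apply: sumr_ge0 => f _; apply: sumr_ge0 => f' _; exact: exprn_ge0.
have := ler_pM (sum0 _ t10) (sum0 _ t20) (sum_agreement l m t10) (sum_agreement l m t20).
move=> /(ler_wpM2l (sqr_ge0 (c * gm)))/le_trans; apply.
have mR0 : m%:R != 0 :> R by rewrite pnatr_eq0 -lt0n.
rewrite le_eqVlt; apply/orP; left; apply/eqP.
have -> : c * gm = (m%:R ^- 2) ^+ l.
  rewrite /c natrX invfM -mulrA mulVf ?gt_eqF// mulr1.
  by rewrite [RHS]exprVn -!exprM mulnC.
rewrite exprAC -!exprMn; congr (_ ^+ _); rewrite -/t1 -/t2.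
by field.
Qed.

End second_moment.

(** * Tail bounds *)

Section tails.
Context (R : realType) d1 d2 (T1 : measurableType d1) (T2 : measurableType d2).
Variables (nu1 : probability T1 R) (nu2 : probability T2 R) (U : T1 * T2 -> R).
Hypothesis hU : bigraphon U.
Variable p : R.
Hypothesis hp : ess_sup (nu1 \x nu2)%E (EFin \o U) = p%:E.

Lemma prob_gt_ess_sup : prob (nu1 \x nu2)%E [set z | p < U z] = 0.
Proof.
have mp : measurable [set z | p < U z] by apply: measurable_superlevel; exact: hU.1.
have := ess_sup_ge (nu1 \x nu2)%E (EFin \o U); rewrite hp => -[N [mN N0 sub]].
apply/eqP; rewrite eq_le prob_ge0 andbT.
rewrite (_ : 0 = prob (nu1 \x nu2)%E N); last exact: (congr1 fine (esym N0)).
apply: le_prob => // z pz; apply: sub => /=.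
by rewrite lee_fin leNgt pz.
Qed.

(** Otherwise [r] would be an essential upper bound smaller than [p]. *)
Lemma prob_ge_below_ess_sup (r : R) : r < p ->
  0 < prob (nu1 \x nu2)%E [set z | r <= U z].
Proof.
move=> rp; rewrite lt0r prob_ge0 andbT; apply/eqP => r0.
have mr : measurable [set z | r <= U z].
  by rewrite -[X in measurable X]setTI; apply: measurable_fun_le => //; exact: hU.1.
suff : (ess_sup (nu1 \x nu2)%E (EFin \o U) <= r%:E)%E by rewrite hp lee_fin leNgt rp.
apply/ess_supP; exists [set z | r <= U z]; split=> //.
  by apply: etrans (probE (nu1 \x nu2)%E mr) _; rewrite r0.
by move=> z /= /negP; rewrite lee_fin -ltNge => /ltW.
Qed.

(** Merges the correlation gain [q ^- l] and the neighbourhood loss [(1 - dl) ^- l] into the single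
    rate [sg ^- l], leaving only a constant factor. *)
Lemma bigraphon_pr_biclique_lt_ess_sup (sg : R) : p <= 1 -> 0 < sg -> sg ^+ 2 < p ->
  exists2 K : R, 0 < K & forall n l m, (l * m <= n)%N -> (0 < m)%N ->
    bigraphon_pr nu1 nu2 U
      (fun E : {set 'I_n * 'I_n} => (biclique_number E < l)%N) <=
    (1 + K * sg ^- l / m%:R) ^+ (2 * l) - 1.
Proof.
(* [q ^+ 2] is the midpoint of [sg ^+ 2] and [p], so [sg < q] and [{U >= q ^+ 2}] has positive
   measure. *)
move=> p1 sg0 sgp; pose q := Num.sqrt ((sg ^+ 2 + p) / 2).
have sg20 : 0 < sg ^+ 2 by rewrite exprn_gt0.
have q2 : q ^+ 2 = (sg ^+ 2 + p) / 2 by rewrite sqr_sqrtr//; lra.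
have q0 : 0 < q by rewrite sqrtr_gt0; lra.
have sgq : sg < q by rewrite -(ltr_pXn2r (n := 2)) ?nnegrE ?ltW// q2; lra.
have q1 : q <= 1 by rewrite -(ler_pXn2r (n := 2)) ?nnegrE ?ltW// q2 expr1n; lra.
(* The choice [dl = 1 - sg / q] makes [q * (1 - dl)] equal to [sg]. *)
have dl01 : 0 < 1 - sg / q < 1.
  by rewrite subr_gt0 ltr_pdivrMr// mul1r sgq/= gtrBl divr_gt0.
have q2p : q ^+ 2 < p by rewrite q2; lra.
have mS : measurable [set z | q ^+ 2 <= U z].
  by rewrite -[X in measurable X]setTI; apply: measurable_fun_le => //; exact: hU.1.
have dl01' : 0 < 1 - sg / q <= 1 by case/andP: dl01 => -> /ltW.
have [A [B [mA mB A0 B0 dense]]] :=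
  dense_sections mS (prob_ge_below_ess_sup q2p) dl01'.
pose a := prob nu1 A; pose b := prob nu2 B.
have a1 : a <= 1 by exact: prob_le1.
have b1 : b <= 1 by exact: prob_le1.
(* One constant for both sides: it dominates [2 / a] and [2 / b] because [a, b <= 1]. *)
exists (2 / (a * b)); first by rewrite divr_gt0// mulr_gt0.
move=> n l m lmn m0; have q01 : 0 < q <= 1 by rewrite q0.
apply: le_trans (bigraphon_pr_biclique_lt hU mA mB A0 B0 dl01 q01 dense lmn m0) _.
have E t : 0 < t -> q ^- l * (t * nbhd_ratio (1 - sg / q) l)^-1 = 2 / t * sg ^- l.
  move=> t0; rewrite /nbhd_ratio subKr exprMn exprVn; field.
  by rewrite !lt0r_neq0// exprn_gt0.
have le_ab t : 0 < t -> a * b <= t -> 2 / t <= 2 / (a * b).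
  by move=> t0 abt; rewrite ler_pM2l// lef_pV2// posrE// mulr_gt0.
have v0 : 0 <= sg ^- l / m%:R by rewrite mulr_ge0// invr_ge0 ?ler0n// exprn_ge0// ltW.
rewrite lerD2r exprM !E// -!mulrA.
have ge1 t : 0 < t -> 0 <= 1 + 2 * (t^-1 * (sg ^- l / m%:R)).
  move=> t0; apply: addr_ge0 => //; apply: mulr_ge0 => //.
  by apply: mulr_ge0 => //; rewrite invr_ge0 ltW.
have ab0 : 0 < a * b by rewrite mulr_gt0.
apply: lerXn2r; rewrite ?nnegrE.
- by apply: mulr_ge0; exact: ge1.
- by apply: exprn_ge0; exact: ge1.
rewrite expr2; apply: ler_pM; rewrite ?ge1// lerD2l !mulrA ler_wpM2r//;
  rewrite ?invr_ge0 ?ler0n// ler_wpM2r ?invr_ge0 ?exprn_ge0 ?(ltW sg0)//.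
  by apply: le_ab => //; rewrite -[leRHS]mulr1 ler_pM2l.
by apply: le_ab => //; rewrite -[leRHS]mul1r ler_pM2r.
Qed.

End tails.

Lemma cvgr_ln_nat (R : realType) : (ln n%:R : R) @[n --> \oo] --> +oo.
Proof.
apply/cvgryPge => A; have /cvgryPge/(_ (expR A)) := @cvgr_idn R.
apply: filterS => n An; have n0 : 0 < n%:R :> R by exact: lt_le_trans (expR_gt0 A) An.
by rewrite -(expRK A) ler_ln// posrE expR_gt0.
Qed.

(** * Choice of parameters in the two tails *)

Section concentration.
Context (R : realType) d1 d2 (T1 : measurableType d1) (T2 : measurableType d2).
Variables (nu1 : probability T1 R) (nu2 : probability T2 R) (U : T1 * T2 -> R).
Hypothesis hU : bigraphon U.
Variable p : R.
Hypothesis hp : ess_sup (nu1 \x nu2)%E (EFin \o U) = p%:E.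
Hypothesis hp01 : 0 < p < 1.

Let p0 : 0 < p. Proof. by have /andP[] := hp01. Qed.
Let L : R := - ln p.
Let L0 : 0 < L. Proof. by rewrite oppr_gt0; exact: ln_lt0. Qed.
Let pE : p = expR (- L). Proof. by rewrite opprK lnK. Qed.

(** The successor makes [l] at least [(2 / L + e) * ln n], so [n ^ 2 * p ^ l <= n ^ (- L e) <= 1];
    as [l >= 1], the power [l] only decreases it. *)
Lemma biclique_upper_tail (e : R) n (l := (Num.truncn ((2 / L + e) * ln n%:R)).+1) :
  0 < e -> (0 < n)%N ->
  bigraphon_pr nu1 nu2 U
    (fun E : {set 'I_n * 'I_n} => (l <= biclique_number E)%N) <=
  expR (- (L * e * ln n%:R)).
Proof.
move=> e0 n0; set x := ln n%:R.
have nE : n%:R = expR x by rewrite lnK// posrE ltr0n.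
have x0 : 0 <= x by rewrite ln_ge0// ler1n.
apply: le_trans (bigraphon_pr_biclique_ge hU (ltW p0) (prob_gt_ess_sup hU hp) n l) _.
have lx : (2 / L + e) * x <= l%:R by exact: ltW (truncnS_gt _).
have base : n%:R ^+ 2 * p ^+ l <= expR (- (L * e * x)).
  rewrite nE pE -!expRM_natl -expRD ler_expR.
  have : L * ((2 / L + e) * x) <= L * l%:R by rewrite ler_pM2l.
  have -> : L * ((2 / L + e) * x) = 2 * x + L * e * x by field; rewrite gt_eqF.
  by lra.
have y0 : 0 <= n%:R ^+ 2 * p ^+ l by rewrite mulr_ge0// ?exprn_ge0// ltW.
have y1 : n%:R ^+ 2 * p ^+ l <= 1.
  by rewrite (le_trans base)// expR_le1 oppr_le0 !mulr_ge0// ltW.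
by apply: le_trans base; rewrite -[leRHS]expr1; exact: ler_wiXn2l.
Qed.

(** For [sg] close to [sqrt p], [sg ^- l] is at most a constant times [n ^ (1 - dl)], while blocks
    have size about [n / l]; what remains is [l ^ 2 * n ^ (- dl)], which is at most a constant over
    [ln n]. *)
Lemma biclique_lower_tail (e : R) : 0 < e <= 1 / L ->
  exists2 C : R, 0 < C & forall n,
    let l := (Num.truncn ((2 / L - e) * ln n%:R)).+1 in
    1 <= ln n%:R :> R -> 2 * (2 / L) <= ln n%:R ->
    bigraphon_pr nu1 nu2 U
      (fun E : {set 'I_n * 'I_n} => (biclique_number E < l)%N) <=
    expR (C / ln n%:R) - 1.
Proof.
move=> /andP[e0 eL]; pose kp := 2 / L; pose dl := e * L / 4.
have dl0 : 0 < dl by rewrite divr_gt0// mulr_gt0.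
(* [sg = p ^ ((1 + dl) / 2)], slightly below [sqrt p]. *)
pose La := L / 2 * (1 + dl); pose sg := expR (- La).
have sgp : sg ^+ 2 < p.
  rewrite pE -expRM_natl ltr_expR /La; have : 0 < L * dl by exact: mulr_gt0.
  by lra.
have [K K0 tail] := bigraphon_pr_biclique_lt_ess_sup hU hp (ltW (andP hp01).2)
  (expR_gt0 (- La)) sgp.
have kp0 : 0 < kp by rewrite divr_gt0.
(* [6 / dl ^+ 3] comes from [expR (dl * x) >= (dl * x) ^+ 3 / 6], and [(1 + kp) ^+ 2] from
   [l <= (1 + kp) * x]. *)
pose C := 4 * K * expR La * (1 + kp) ^+ 2 * 6 / dl ^+ 3.
exists C; first by rewrite /C !mulr_gt0 ?invr_gt0 ?exprn_gt0 ?expR_gt0// addr_gt0.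
move=> n l; set x := ln n%:R => x1 xkp.
have x0 : 0 < x by lra.
have n1 : 1 < n%:R :> R.
  by rewrite ltNge; apply/negP => /ln_le0; rewrite -/x; lra.
have nE : n%:R = expR x by rewrite lnK// posrE; lra.
(* [e <= 1 / L] keeps the truncated number nonnegative, so that it bounds [l - 1] from above. *)
have c0 : 0 <= (kp - e) * x.
  rewrite mulr_ge0 ?(ltW x0)// subr_ge0 (le_trans eL)// ler_pM2r ?invr_gt0//.
  by lra.
have l_le : l%:R <= (kp - e) * x + 1.
  by rewrite -natr1 lerD2r; have /andP[] := truncn_itv c0.
have l_le' : l%:R <= 1 + kp * x.
  by apply: le_trans l_le _; rewrite addrC lerD2l ler_pM2r//; lra.
have l1 : 1 <= l%:R :> R by rewrite ler1n.
(* [1 + kp * x <= 1 + x ^+ 2 / 2 <= expR x], using [x >= 2 * kp]. *)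
have ln : (l <= n)%N.
  rewrite -(ler_nat R) nE (le_trans l_le')//.
  apply: le_trans (expR_ge1Dxn 1 (ltW x0)).
  rewrite lerD2l (_ : 2`!%:R = 2 :> R)// expr2 ler_pdivlMr// -/kp in xkp *.
  by rewrite mulrAC ler_pM2r// mulrC.
pose m := (n %/ l)%N.
have m0 : (0 < m)%N by rewrite divn_gt0.
(* The remainder is below [l], hence at most [l * m]: rounding the block size costs a factor [2]. *)
have mge : n%:R <= 2 * l%:R * m%:R :> R.
  rewrite -!natrM ler_nat {1}(divn_eq n l) -/m.
  have rl : (n %% l <= l)%N by rewrite ltnW// ltn_mod.
  rewrite -mulnA mul2n -addnn mulnC leq_add2l (leq_trans rl)//.
  by rewrite leq_pmulr.
have lmn : (l * m <= n)%N by rewrite mulnC leq_trunc_div.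
clearbody m l.
apply: le_trans (tail n l m lmn m0) _; rewrite lerD2r.
have mR0 : 0 < m%:R :> R by rewrite ltr0n.
have sgl : sg ^- l <= expR La * expR ((1 - dl) * x).
  rewrite -exprVn -expRN opprK -expRM_natl -expRD ler_expR.
  have La0 : 0 < La by rewrite mulr_gt0 ?divr_gt0// addr_gt0.
  rewrite mulrC; apply: le_trans (ler_wpM2l (ltW La0) l_le) _.
  rewrite mulrDr mulr1 addrC lerD2l mulrA ler_pM2r//.
  (* That is, [(1 + dl) * (1 - 2 * dl)], because [e * L = 4 * dl]. *)
  have -> : La * (kp - e) = 1 - dl - 2 * dl ^+ 2.
    by rewrite /La /kp /dl; field; rewrite gt_eqF.
  by rewrite lerBlDr lerDl mulr_ge0// sqr_ge0.
have sg0 : 0 < sg ^- l by rewrite invr_gt0 exprn_gt0// expR_gt0.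
have y0 : 0 <= K * sg ^- l / m%:R by apply/ltW/divr_gt0 => //; exact: mulr_gt0.
apply: (@le_trans _ _ (expR (K * sg ^- l / m%:R) ^+ (2 * l))).
  by apply: lerXn2r; rewrite ?nnegrE ?expR_ge0 ?addr_ge0 ?expR_ge1Dx.
rewrite -expRM_natl ler_expR ler_pdivlMr//.
have minv : m%:R^-1 <= 2 * l%:R * expR (- x).
  have nR0 : 0 < n%:R :> R by apply: lt_trans n1.
  by rewrite expRN -nE -[leLHS]mul1r ler_pdivrMr// mulrAC ler_pdivlMr// mul1r.
apply: (@le_trans _ _ ((2 * l)%:R * (K * (expR La * expR ((1 - dl) * x)) *
    (2 * l%:R * expR (- x))) * x)).
  rewrite ler_pM2r// ler_wpM2l ?ler0n//; apply: ler_pM => //.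
  - by rewrite mulr_ge0// ltW.
  - by rewrite ler_pM2l.
have E3 : expR ((1 - dl) * x) * expR (- x) = (expR (dl * x))^-1.
  by rewrite -expRD -expRN; congr expR; ring.
have -> : (2 * l)%:R * (K * (expR La * expR ((1 - dl) * x)) *
    (2 * l%:R * expR (- x))) * x =
    4 * K * expR La * (l%:R ^+ 2 * x * (expR ((1 - dl) * x) * expR (- x))).
  by rewrite natrM; ring.
have -> : C = 4 * K * expR La * ((1 + kp) ^+ 2 * 6 / dl ^+ 3).
  by rewrite /C; field; rewrite gt_eqF.
rewrite E3 ler_pM2l ?mulr_gt0 ?expR_gt0// ler_pdivrMr ?expR_gt0//.
apply: (@le_trans _ _ ((1 + kp) ^+ 2 * 6 / dl ^+ 3 * ((dl * x) ^+ 3 / 6))).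
  have -> : (1 + kp) ^+ 2 * 6 / dl ^+ 3 * ((dl * x) ^+ 3 / 6) =
      ((1 + kp) * x) ^+ 2 * x by field; rewrite gt_eqF.
  rewrite ler_pM2r//; apply: lerXn2r; rewrite ?nnegrE ?ler0n//.
    by rewrite mulr_ge0 ?addr_ge0// ltW.
  by apply: le_trans l_le' _; rewrite mulrDl mul1r lerD2r.
apply: ler_wpM2l.
  by rewrite mulr_ge0 ?invr_ge0 ?exprn_ge0 ?(ltW dl0)// mulr_ge0// sqr_ge0.
apply: le_trans (expR_ge1Dxn 2 _); last by rewrite mulr_ge0// ltW.
by rewrite (_ : 3`!%:R = 6 :> R)// lerDr.
Qed.

End concentration.

Theorem theorem2p4 (R : realType) (d1 d2 : measure_display)
    (T1 : measurableType d1) (T2 : measurableType d2)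
    (nu1 : probability T1 R) (nu2 : probability T2 R)
    (hT1 : standard_borel R T1) (hT2 : standard_borel R T2)
    (hnu1 : atomless nu1) (hnu2 : atomless nu2)
    (U : T1 * T2 -> R) (hU : bigraphon U) (p : R)
    (hp : ess_sup (nu1 \x nu2)%E (EFin \o U) = p%:E) (hp01 : 0 < p < 1)
    (eps : R) (heps : 0 < eps) :
  bigraphon_pr nu1 nu2 U
    (fun E : {set 'I_n * 'I_n} =>
       `| (biclique_number E)%:R - 2 / ln (1 / p) * ln n%:R |
         <= eps * ln n%:R) @[n --> \oo] --> (1 : R).
Proof.
have /andP[p0 p1] := hp01; pose L := - ln p.
have L0 : 0 < L by rewrite oppr_gt0; exact: ln_lt0.
have -> : ln (1 / p) = L by rewrite div1r lnV.
(* The lower tail needs [e <= 1 / L]; shrinking the window only strengthens the claim. *)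
pose e := Num.min eps (1 / L).
have e0 : 0 < e by rewrite lt_min heps divr_gt0.
have e_eps : e <= eps by rewrite ge_min lexx.
have eL : 0 < e <= 1 / L by rewrite e0 ge_min lexx orbT.
have [C C0 lower] := biclique_lower_tail hU hp hp01 eL.
have lny := @cvgr_ln_nat R.
apply: (@squeeze_cvgr _ _ _ _
  (fun n => 1 - (expR (- (L * e * ln n%:R)) + (expR (C / ln n%:R) - 1))) (cst 1)).
- near=> n.
  have x1 : 1 <= ln n%:R :> R by near: n; move/cvgryPge : lny; exact.
  have xL : 2 * (2 / L) <= ln n%:R :> R by near: n; move/cvgryPge : lny; exact.
  have n0 : (0 < n)%N by near: n; exact: nbhs_infty_gt.
  rewrite bigraphon_prC//; apply/andP; split; last first.
    by rewrite /= gerBl bigraphon_pr_ge0.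
  rewrite lerD2l lerN2.
  have upper := biclique_upper_tail hU hp hp01 e0 n0.
  apply: le_trans (lerD upper (lower n x1 xL)).
  (* Contrapositive: a graph in neither tail has biclique number within [e * ln n] of the centre. *)
  apply: bigraphon_pr_leU => // E /=; apply: contraNT; rewrite negb_or -ltnNge -leqNgt.
  move=> /andP[lu ll]; rewrite -/L in lu ll; set w := biclique_number E in lu ll *.
  have x0 : 0 <= ln n%:R :> R by apply: le_trans x1.
  have ub : w%:R <= (2 / L + e) * ln n%:R :> R.
    have c0 : 0 <= (2 / L + e) * ln n%:R :> R.
      by rewrite mulr_ge0// addr_ge0 ?(ltW e0)// divr_ge0// ltW.
    have /andP[+ _] := truncn_itv c0; apply: le_trans.
    by rewrite ler_nat -ltnS.
  have lb : (2 / L - e) * ln n%:R <= w%:R :> R.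
    by apply: le_trans (ltW (truncnS_gt _)) _; rewrite ler_nat.
  have ee : e * ln n%:R <= eps * ln n%:R :> R by rewrite ler_wpM2r.
  rewrite mulrDl in ub; rewrite mulrBl in lb.
  by rewrite ler_norml; apply/andP; split; lra.
- rewrite -[X in _ --> X](_ : 1 - (0 + (expR 0 - 1)) = 1 :> R); last first.
    by rewrite expR0 subrr addr0 subr0.
  apply: cvgB; first exact: cvg_cst.
  apply: cvgD.
    have Le : (L * e * ln n%:R : R) @[n --> \oo] --> +oo.
      apply/cvgryPge => c; near=> n; rewrite mulrC -ler_pdivrMr ?mulr_gt0//.
      by near: n; move/cvgryPge : lny; exact.
    exact: (cvg_comp _ _ Le (@cvgr_expR R)).
  apply: cvgB; last exact: cvg_cst.
  have C_ln : (C / ln n%:R : R) @[n --> \oo] --> C * 0.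
    apply: cvgM; first exact: cvg_cst.
    apply/gtr0_cvgV0 => //; near=> n.
    have x1 : 1 <= ln n%:R :> R by near: n; move/cvgryPge : lny; exact.
    exact: lt_le_trans x1.
  rewrite mulr0 in C_ln.
  exact: (cvg_comp _ _ C_ln (@continuous_expR R 0)).
- exact: cvg_cst.
Unshelve. all: by end_near.
Qed.
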